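(* Let $\mathcal{C}$ be a braided monoidal category, $H$ a Hopf algebra in $\mathcal{C}$ and $\mathcal{A}=(H\xrightarrow{\pi}A,B,\omega)$ a partial dualization datum for $H$, where $\mathcal{C}$ has equalizers and $A\otimes-$ and $B\otimes -$ preserve equalizers. Write $H=K\rtimes A$ with $K$ a Hopf algebra in ${}_A^A\mathcal{YD}(\mathcal{C})$, and let $r_{\mathcal{A}}(H)=\Omega^\omega(K)\rtimes B$ be the partial dual, with its projection $\pi':r_{\mathcal{A}}(H)\to B$. Let $\mathcal{A}^-=(r_{\mathcal{A}}(H)\xrightarrow{\pi'}B,A,\omega^-)$ with $\omega^-=\omega\circ c^{-1}_{A,B}\circ(S_B^{-1}\otimes S_A^{-1}):B\otimes A\to\mathbf 1$. Then the two-fold partial dualization $r_{\mathcal{A}^-}(r_{\mathcal{A}}(H))$ is isomorphic to $H$ as a Hopf algebra in $\mathcal{C}$; an isomorphism of Hopf algebras is $$ r_{\mathcal{A}^-}(r_{\mathcal{A}}(H))=\Omega^{\omega^-}(\Omega^\omega(K))\rtimes A\xrightarrow{\ \theta_K\otimes \mathrm{id}_A\ }K\rtimes A=H,\qquad \theta_K=\rho_K\circ(S_A\otimes \mathrm{id}_K)\circ\delta_K, $$ where $\rho_K$ and $\delta_K$ are the $A$-action and $A$-coaction on $K$.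
   Context: $\mathcal{C}$ is a (strict) braided monoidal category with tensor product $\otimes$, unit $\mathbf 1$, braiding $c_{X,Y}:X\otimes Y\to Y\otimes X$. Hopf algebra in $\mathcal{C}$: an object $A$ with a unital associative algebra structure $(\mu,\eta)$, a counital coassociative coalgebra structure $(\Delta,\varepsilon)$, such that $\Delta\mu=(\mu\otimes\mu)(\mathrm{id}\otimes c_{A,A}\otimes \mathrm{id})(\Delta\otimes\Delta)$, $\varepsilon\mu=\varepsilon\otimes\varepsilon$, $\Delta\eta=\eta\otimes\eta$, $\varepsilon\eta=\mathrm{id}_{\mathbf 1}$, and an invertible antipode $S:A\to A$ with $\mu(S\otimes \mathrm{id})\Delta=\eta\varepsilon=\mu(\mathrm{id}\otimes S)\Delta$. Yetter-Drinfel'd modules: ${}_A^A\mathcal{YD}(\mathcal{C})$ has as objects the triples $(X,\rho,\delta)$, with $\rho:A\otimes X\to X$ a left $A$-action and $\delta:X\to A\otimes X$ a left $A$-coaction, satisfying $(\mu\otimes\rho)(\mathrm{id}_A\otimes c_{A,A}\otimes \mathrm{id}_X)(\Delta\otimes\delta)=(\mu\otimes \mathrm{id}_X)(\mathrm{id}_A\otimes c_{X,A})(\delta\otimes \mathrm{id}_A)(\rho\otimes \mathrm{id}_A)(\mathrm{id}_A\otimes c_{A,X})(\Delta\otimes \mathrm{id}_X)$; morphisms are the $A$-linear and $A$-colinear morphisms. It is monoidal with diagonal action $(\rho_X\otimes\rho_Y)(\mathrm{id}_A\otimes c_{A,X}\otimes \mathrm{id}_Y)(\Delta\otimes \mathrm{id}_{X\otimes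 Y})$ and diagonal coaction $(\mu\otimes \mathrm{id}_{X\otimes Y})(\mathrm{id}_A\otimes c_{X,A}\otimes \mathrm{id}_Y)(\delta_X\otimes\delta_Y)$, and braided by $c^{\mathcal{YD}}_{X,Y}=(\rho_Y\otimes \mathrm{id}_X)(\mathrm{id}_A\otimes c_{X,Y})(\delta_X\otimes \mathrm{id}_Y)$. Hopf pairing: $\omega:A\otimes B\to\mathbf 1$ with $\omega(\mu_A\otimes \mathrm{id})=\omega(\mathrm{id}\otimes\omega\otimes \mathrm{id})(\mathrm{id}_{A\otimes A}\otimes\Delta_B)$, $\omega(\eta_A\otimes \mathrm{id})=\varepsilon_B$, $\omega(\mathrm{id}\otimes\mu_B)=\omega(\mathrm{id}\otimes\omega\otimes \mathrm{id})(\Delta_A\otimes \mathrm{id}_{B\otimes B})$, $\omega(\mathrm{id}\otimes\eta_B)=\varepsilon_A$. It is non-degenerate if there is a (unique) inverse copairing $\omega':\mathbf 1\to B\otimes A$ with $(\omega\otimes \mathrm{id}_A)(\mathrm{id}_A\otimes\omega')=\mathrm{id}_A$, $(\mathrm{id}_B\otimes\omega)(\omega'\otimes \mathrm{id}_B)=\mathrm{id}_B$. If $\omega$ is a non-degenerate Hopf pairing then so is $\omega^-$; its inverse copairing is $(S_A\otimes S_B)\circ c_{B,A}\circ\omega':\mathbf 1\to A\otimes B$. Braided equivalence $\Omega^\omega:{}_A^A\mathcal{YD}(\mathcal{C})\to{}_B^B\mathcal{YD}(\mathcal{C})$ associated to a non-degenerate Hopf pairing $\omega:A\otimes B\to\mathbf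 1$: it is the identity on underlying objects and morphisms of $\mathcal{C}$, and $\Omega^\omega(X,\rho,\delta)=(X,\rho_\Omega,\delta_\Omega)$ with $\rho_\Omega=(\mathrm{id}_X\otimes\omega)(c^{-1}_{X,A}\otimes S_B^{-2})(\delta\otimes \mathrm{id}_B)\,c^{-1}_{X,B}$ and $\delta_\Omega=c_{X,B}\,c_{B,X}\,(S_B^2\otimes\rho)(\omega'\otimes \mathrm{id}_X)$; its monoidal structure is $\Omega^\omega_2(X,Y)=c^{\mathcal{YD}}_{Y,X}\circ c^{-1}_{Y,X}:\Omega^\omega(X)\otimes\Omega^\omega(Y)\to\Omega^\omega(X\otimes Y)$. The functor $\Omega^{\omega^-}:{}_B^B\mathcal{YD}(\mathcal{C})\to{}_A^A\mathcal{YD}(\mathcal{C})$ is the same construction applied to $\omega^-:B\otimes A\to\mathbf 1$. Such a braided functor sends a Hopf algebra $K$ to a Hopf algebra with multiplication $\mu_K\circ\Omega_2(K,K)$ and comultiplication $\Omega_2(K,K)^{-1}\circ\Delta_K$. Radford biproduct: for a Hopf algebra $K$ in ${}_A^A\mathcal{YD}(\mathcal{C})$, $K\rtimes A$ is the Hopf algebra in $\mathcal{C}$ on $K\otimes A$ with unit $\eta_K\otimes\eta_A$, counit $\varepsilon_K\otimes\varepsilon_A$, $\mu=(\mu_K\otimes\mu_A)(\mathrm{id}_K\otimes\rho_K\otimes \mathrm{id}_{A\otimes A})(\mathrm{id}_{K\otimes A}\otimes c_{A,K}\otimes \mathrm{id}_A)(\mathrm{id}_K\otimes\Delta_A\otimes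 \mathrm{id}_{K\otimes A})$, $\Delta=(\mathrm{id}_K\otimes\mu_A\otimes \mathrm{id}_{K\otimes A})(\mathrm{id}_{K\otimes A}\otimes c_{K,A}\otimes \mathrm{id}_A)(\mathrm{id}_K\otimes\delta_K\otimes \mathrm{id}_{A\otimes A})(\Delta_K\otimes\Delta_A)$. Partial dualization: a partial dualization datum $\mathcal{A}=(H\xrightarrow{\pi}A,B,\omega)$ for $H$ consists of a Hopf algebra projection $\pi:H\to A$ onto a Hopf subalgebra $\iota:A\to H$ (so $\pi\iota=\mathrm{id}_A$), and a Hopf algebra $B$ in $\mathcal{C}$ with a non-degenerate Hopf pairing $\omega:A\otimes B\to\mathbf 1$. By the Radford projection theorem (valid if $\mathcal{C}$ has equalizers and $A\otimes-$ preserves them) there is a Hopf algebra $K$ (the coinvariants of $\pi$) in ${}_A^A\mathcal{YD}(\mathcal{C})$ and an isomorphism of Hopf algebras $H\cong K\rtimes A$ identifying $\pi$ with $\varepsilon_K\otimes \mathrm{id}_A$ and $\iota$ with $\eta_K\otimes \mathrm{id}_A$; one identifies $H$ with $K\rtimes A$. The partial dual is $r_{\mathcal{A}}(H):=\Omega^\omega(K)\rtimes B$, with projection $\pi'=\varepsilon_K\otimes \mathrm{id}_B$ onto $B$ (split by $\eta_K\otimes \mathrm{id}_B$); the coinvariants of $\pi'$ are $\Omega^\omega(K)$. *)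

(* Defs.v *)
From Stdlib Require Import ssreflect ssrbool ClassicalEpsilon.

Set Implicit Arguments.
Unset Strict Implicit.
Unset Printing Implicit Defensive.

Declare Scope smc_scope.
Delimit Scope smc_scope with smc.
Local Open Scope smc_scope.

(** A category is presented by objects, arrows, domain and codomain maps (as in
    Mac Lane's book).  Strict associativity and unitality of the tensor product
    of arrows are then plain equations, without transport along equalities of
    objects.  Composition is a total function, but its values on
    non-composable pairs are arbitrary: every law involving a composite is
    restricted to composable arrows.  [comp g f] is "g after f". *)
Record strict_monoidal_category := StrictMonoidalCategory {
  Ob : Type;
  Mor : Type;
  dom : Mor -> Ob;
  cod : Mor -> Ob;
  idm : Ob -> Mor;
  comp : Mor -> Mor -> Mor;
  dom_idm : forall X, dom (idm X) = X;
  cod_idm : forall X, cod (idm X) = X;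
  dom_comp : forall g f, cod f = dom g -> dom (comp g f) = dom f;
  cod_comp : forall g f, cod f = dom g -> cod (comp g f) = cod g;
  comp_assoc : forall h g f, cod f = dom g -> cod g = dom h ->
    comp h (comp g f) = comp (comp h g) f;
  comp_idm_l : forall f, comp (idm (cod f)) f = f;
  comp_idm_r : forall f, comp f (idm (dom f)) = f;

  tensO : Ob -> Ob -> Ob;
  tens : Mor -> Mor -> Mor;
  unitO : Ob;
  dom_tens : forall f g, dom (tens f g) = tensO (dom f) (dom g);
  cod_tens : forall f g, cod (tens f g) = tensO (cod f) (cod g);
  tens_idm : forall X Y, tens (idm X) (idm Y) = idm (tensO X Y);
  tens_comp : forall g f g' f', cod f = dom g -> cod f' = dom g' ->
    tens (comp g f) (comp g' f') = comp (tens g g') (tens f f');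
  tensO_assoc : forall X Y Z, tensO X (tensO Y Z) = tensO (tensO X Y) Z;
  tensO_unit_l : forall X, tensO unitO X = X;
  tensO_unit_r : forall X, tensO X unitO = X;
  tens_assoc : forall f g h, tens f (tens g h) = tens (tens f g) h;
  tens_unit_l : forall f, tens (idm unitO) f = f;
  tens_unit_r : forall f, tens f (idm unitO) = f
}.

Arguments idm {s} _.
Arguments unitO {s}.

Notation "g ∘ f" := (comp g f) (at level 40, left associativity) : smc_scope.
Notation "f ⊗ g" := (tens f g) (at level 30, right associativity) : smc_scope.
Notation "X ⊠ Y" := (tensO X Y) (at level 30, right associativity) : smc_scope.
Notation "f ∈ X ⟶ Y" := (dom f = X /\ cod f = Y)
  (at level 70, X at level 65, Y at level 65) : smc_scope.

Section Arrows.
Variable C : strict_monoidal_category.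
Implicit Types f g e : Mor C.

Definition is_inverse f g : Prop :=
  g ∈ cod f ⟶ dom f /\ g ∘ f = idm (dom f) /\ f ∘ g = idm (cod f).

Definition is_iso f : Prop := exists g, is_inverse f g.

(** Choice of an arrow satisfying [P], meant for [P] having exactly one
    solution; nothing is known about [the P] if [P] has no solution. *)
Definition the (P : Mor C -> Prop) : Mor C := epsilon (inhabits (idm unitO)) P.

Definition inv f : Mor C := the (is_inverse f).

Definition is_equalizer f g e : Prop :=
  [/\ dom f = dom g, cod f = cod g, cod e = dom f, f ∘ e = g ∘ e &
      forall h, cod h = dom f -> f ∘ h = g ∘ h ->
        exists! u, u ∈ dom h ⟶ dom e /\ e ∘ u = h].

Definition has_equalizers : Prop :=
  forall f g, dom f = dom g -> cod f = cod g -> exists e, is_equalizer f g e.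

Definition tensor_preserves_equalizers (X : Ob C) : Prop :=
  forall f g e, is_equalizer f g e ->
    is_equalizer (idm X ⊗ f) (idm X ⊗ g) (idm X ⊗ e).

End Arrows.

Record braided_category := BraidedCategory {
  smc :> strict_monoidal_category;
  br : Ob smc -> Ob smc -> Mor smc;
  br_hom : forall X Y, br X Y ∈ X ⊠ Y ⟶ Y ⊠ X;
  br_iso : forall X Y, is_iso (br X Y);
  br_natural : forall f g : Mor smc,
    br (cod f) (cod g) ∘ (f ⊗ g) = (g ⊗ f) ∘ br (dom f) (dom g);
  br_hexagon_r : forall X Y Z,
    br X (Y ⊠ Z) = (idm Y ⊗ br X Z) ∘ (br X Y ⊗ idm Z);
  br_hexagon_l : forall X Y Z,
    br (X ⊠ Y) Z = (br X Z ⊗ idm Y) ∘ (idm X ⊗ br Y Z)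
}.

Section Hopf.
Variable C : braided_category.

(** Underlying data of a bialgebra or of a Hopf algebra; the antipode, being
    unique, is not part of the data. *)
Record bialg := Bialg {
  carrier :> Ob C;
  mul : Mor C;
  one : Mor C;
  comul : Mor C;
  counit : Mor C
}.

(** Bialgebra axioms with respect to a self-braiding [c] of the carrier, so that
    they apply both to [C] and to Yetter-Drinfel'd modules. *)
Record is_bialgebra (c : Mor C) (H : bialg) : Prop := IsBialgebra {
  mul_hom : mul H ∈ H ⊠ H ⟶ H;
  one_hom : one H ∈ unitO ⟶ H;
  comul_hom : comul H ∈ H ⟶ H ⊠ H;
  counit_hom : counit H ∈ H ⟶ unitO;
  mul_assoc : mul H ∘ (mul H ⊗ idm H) = mul H ∘ (idm H ⊗ mul H);
  mul_one_l : mul H ∘ (one H ⊗ idm H) = idm H;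
  mul_one_r : mul H ∘ (idm H ⊗ one H) = idm H;
  comul_coassoc : (comul H ⊗ idm H) ∘ comul H = (idm H ⊗ comul H) ∘ comul H;
  counit_comul_l : (counit H ⊗ idm H) ∘ comul H = idm H;
  counit_comul_r : (idm H ⊗ counit H) ∘ comul H = idm H;
  comul_mul : comul H ∘ mul H =
    (mul H ⊗ mul H) ∘ (idm H ⊗ c ⊗ idm H) ∘ (comul H ⊗ comul H);
  counit_mul : counit H ∘ mul H = counit H ⊗ counit H;
  comul_one : comul H ∘ one H = one H ⊗ one H;
  counit_one : counit H ∘ one H = idm unitO
}.

Definition is_antipode (H : bialg) (S : Mor C) : Prop :=
  [/\ S ∈ H ⟶ H, is_iso S,
      mul H ∘ (S ⊗ idm H) ∘ comul H = one H ∘ counit H &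
      mul H ∘ (idm H ⊗ S) ∘ comul H = one H ∘ counit H].

Definition is_hopf (H : bialg) : Prop :=
  is_bialgebra (br H H) H /\ exists S, is_antipode H S.

Definition antipode (H : bialg) : Mor C := the (is_antipode H).

(** Compatibility with the antipodes is automatic. *)
Definition is_hopf_morphism (H H' : bialg) (f : Mor C) : Prop :=
  [/\ f ∈ H ⟶ H', f ∘ mul H = mul H' ∘ (f ⊗ f), f ∘ one H = one H',
      comul H' ∘ f = (f ⊗ f) ∘ comul H & counit H' ∘ f = counit H].

Definition is_hopf_iso (H H' : bialg) (f : Mor C) : Prop :=
  is_hopf_morphism H H' f /\ is_iso f.

Section YetterDrinfeld.
Variable A : bialg.

Record yd := YD {
  yd_ob :> Ob C;
  act : Mor C;
  coact : Mor C
}.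

Record is_yd (X : yd) : Prop := IsYD {
  act_hom : act X ∈ A ⊠ X ⟶ X;
  coact_hom : coact X ∈ X ⟶ A ⊠ X;
  act_mul : act X ∘ (mul A ⊗ idm X) = act X ∘ (idm A ⊗ act X);
  act_one : act X ∘ (one A ⊗ idm X) = idm X;
  coact_comul : (comul A ⊗ idm X) ∘ coact X = (idm A ⊗ coact X) ∘ coact X;
  coact_counit : (counit A ⊗ idm X) ∘ coact X = idm X;
  yd_condition :
    (mul A ⊗ act X) ∘ (idm A ⊗ br A A ⊗ idm X) ∘ (comul A ⊗ coact X) =
    (mul A ⊗ idm X) ∘ (idm A ⊗ br X A) ∘ (coact X ⊗ idm A)
      ∘ (act X ⊗ idm A) ∘ (idm A ⊗ br A X) ∘ (comul A ⊗ idm X)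
}.

Definition is_yd_morphism (X Y : yd) (f : Mor C) : Prop :=
  [/\ f ∈ X ⟶ Y, f ∘ act X = act Y ∘ (idm A ⊗ f) &
      coact Y ∘ f = (idm A ⊗ f) ∘ coact X].

Definition yd_unit : yd := YD unitO (counit A) (one A).

Definition yd_tens (X Y : yd) : yd := YD
  (X ⊠ Y)
  ((act X ⊗ act Y) ∘ (idm A ⊗ br A X ⊗ idm Y) ∘ (comul A ⊗ idm (X ⊠ Y)))
  ((mul A ⊗ idm (X ⊠ Y)) ∘ (idm A ⊗ br X A ⊗ idm Y) ∘ (coact X ⊗ coact Y)).

Definition yd_br (X Y : yd) : Mor C :=
  (act Y ⊗ idm X) ∘ (idm A ⊗ br X Y) ∘ (coact X ⊗ idm Y).

Record yd_bialg := YDBialg {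
  yd_alg :> bialg;
  yd_act : Mor C;
  yd_coact : Mor C
}.

Definition yd_mod (K : yd_bialg) : yd := YD K (yd_act K) (yd_coact K).

(** Hopf algebra in the braided category of Yetter-Drinfel'd modules over [A]:
    the structure arrows are morphisms of Yetter-Drinfel'd modules. *)
Record is_yd_hopf (K : yd_bialg) : Prop := IsYDHopf {
  yd_hopf_yd : is_yd (yd_mod K);
  yd_hopf_mul :
    is_yd_morphism (yd_tens (yd_mod K) (yd_mod K)) (yd_mod K) (mul K);
  yd_hopf_one : is_yd_morphism yd_unit (yd_mod K) (one K);
  yd_hopf_comul :
    is_yd_morphism (yd_mod K) (yd_tens (yd_mod K) (yd_mod K)) (comul K);
  yd_hopf_counit : is_yd_morphism (yd_mod K) yd_unit (counit K);
  yd_hopf_bialgebra : is_bialgebra (yd_br (yd_mod K) (yd_mod K)) K;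
  yd_hopf_antipode :
    exists S, is_yd_morphism (yd_mod K) (yd_mod K) S /\ is_antipode K S
}.

Definition biproduct (K : yd_bialg) : bialg := Bialg
  (K ⊠ A)
  ((mul K ⊗ mul A) ∘ (idm K ⊗ yd_act K ⊗ idm (A ⊠ A))
    ∘ (idm (K ⊠ A) ⊗ br A K ⊗ idm A) ∘ (idm K ⊗ comul A ⊗ idm (K ⊠ A)))
  (one K ⊗ one A)
  ((idm K ⊗ mul A ⊗ idm (K ⊠ A)) ∘ (idm (K ⊠ A) ⊗ br K A ⊗ idm A)
    ∘ (idm K ⊗ yd_coact K ⊗ idm (A ⊠ A)) ∘ (comul K ⊗ comul A))
  (counit K ⊗ counit A).

Definition theta (K : yd_bialg) : Mor C :=
  yd_act K ∘ (antipode A ⊗ idm K) ∘ yd_coact K.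

End YetterDrinfeld.

Section Pairing.
Variables A B : bialg.
Variable w : Mor C.

Definition is_hopf_pairing : Prop :=
  [/\ w ∈ A ⊠ B ⟶ unitO,
      w ∘ (mul A ⊗ idm B) =
        w ∘ (idm A ⊗ w ⊗ idm B) ∘ (idm (A ⊠ A) ⊗ comul B),
      w ∘ (one A ⊗ idm B) = counit B,
      w ∘ (idm A ⊗ mul B) =
        w ∘ (idm A ⊗ w ⊗ idm B) ∘ (comul A ⊗ idm (B ⊠ B)) &
      w ∘ (idm A ⊗ one B) = counit A].

Definition is_inverse_copairing (w' : Mor C) : Prop :=
  [/\ w' ∈ unitO ⟶ B ⊠ A,
      (w ⊗ idm A) ∘ (idm A ⊗ w') = idm A &
      (idm B ⊗ w) ∘ (w' ⊗ idm B) = idm B].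

Definition is_nondegenerate : Prop := exists w', is_inverse_copairing w'.

Definition copairing : Mor C := the is_inverse_copairing.

Definition pairing_minus : Mor C :=
  w ∘ inv (br A B) ∘ (inv (antipode B) ⊗ inv (antipode A)).

Definition Omega_act (X : yd) : Mor C :=
  (idm X ⊗ w) ∘ (inv (br X A) ⊗ (inv (antipode B) ∘ inv (antipode B)))
    ∘ (coact X ⊗ idm B) ∘ inv (br X B).

Definition Omega_coact (X : yd) : Mor C :=
  br X B ∘ br B X ∘ ((antipode B ∘ antipode B) ⊗ act X) ∘ (copairing ⊗ idm X).

(** The monoidal constraint Omega(X) ⊗ Omega(Y) -> Omega(X ⊗ Y); here the
    Yetter-Drinfel'd braiding is the one over [A]. *)
Definition Omega2 (X Y : yd) : Mor C := yd_br A Y X ∘ inv (br Y X).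

Definition Omega (K : yd_bialg) : yd_bialg :=
  let X := yd_mod K in
  YDBialg
    (Bialg K
      (mul K ∘ Omega2 X X) (one K) (inv (Omega2 X X) ∘ comul K) (counit K))
    (Omega_act X) (Omega_coact X).

End Pairing.

(** Data of a partial dualization datum (pi : H -> A, B, w), including the
    embedding iota : A -> H. *)
Record pd_datum := PDDatum {
  pd_A : bialg;
  pd_pi : Mor C;
  pd_iota : Mor C;
  pd_B : bialg;
  pd_pairing : Mor C
}.

Record is_pd_datum (H : bialg) (D : pd_datum) : Prop := IsPDDatum {
  pd_hopf_A : is_hopf (pd_A D);
  pd_hopf_B : is_hopf (pd_B D);
  pd_pi_morphism : is_hopf_morphism H (pd_A D) (pd_pi D);
  pd_iota_morphism : is_hopf_morphism (pd_A D) H (pd_iota D);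
  pd_split : pd_pi D ∘ pd_iota D = idm (pd_A D);
  pd_hopf_pairing : is_hopf_pairing (pd_A D) (pd_B D) (pd_pairing D);
  pd_nondegenerate : is_nondegenerate (pd_A D) (pd_B D) (pd_pairing D)
}.

(** [K] is the Hopf algebra of coinvariants of the projection of [D], and [phi]
    identifies the biproduct of [K] and [pd_A D] with [H]. *)
Record is_radford_decomposition
    (H : bialg) (D : pd_datum) (K : yd_bialg) (phi : Mor C) : Prop :=
  IsRadfordDecomposition {
  rd_hopf : is_yd_hopf (pd_A D) K;
  rd_iso : is_hopf_iso (biproduct (pd_A D) K) H phi;
  rd_pi : pd_pi D ∘ phi = counit K ⊗ idm (pd_A D);
  rd_iota : phi ∘ (one K ⊗ idm (pd_A D)) = pd_iota D;
  rd_coinvariants : is_equalizer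
    ((idm H ⊗ pd_pi D) ∘ comul H) (idm H ⊗ one (pd_A D))
    (phi ∘ (idm K ⊗ one (pd_A D)))
}.

(** The functor of [D] applied to the coinvariants [K]. *)
Definition pd_coinv (D : pd_datum) (K : yd_bialg) : yd_bialg :=
  Omega (pd_A D) (pd_B D) (pd_pairing D) K.

(** The partial dual of a Hopf algebra whose coinvariants are [K]. *)
Definition partial_dual (D : pd_datum) (K : yd_bialg) : bialg :=
  biproduct (pd_B D) (pd_coinv D K).

Definition pd_datum_minus (D : pd_datum) (K : yd_bialg) : pd_datum :=
  let K' := pd_coinv D K in
  PDDatum
    (pd_B D)
    (counit K' ⊗ idm (pd_B D))
    (one K' ⊗ idm (pd_B D))
    (pd_A D)
    (pairing_minus (pd_A D) (pd_B D) (pd_pairing D)).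

End Hopf.

(* Main.v *)
From mathcomp Require Import ssreflect ssrfun ssrbool eqtype ssrnat seq.
Require Import Defs.

(** Let [w : A ⊗ B -> 1] be the pairing, [k : B ⊗ A -> 1] the pairing that the second
    dualization uses, and [k' : 1 -> A ⊗ B] the copairing of [k].

    The functor Omega becomes simpler when it is expressed by [k] and [k'] instead of
    [w].  No antipodes are left: [B] acts on [X] by [k] and the coaction of [A], and
    coacts by [k'] and the right action of [A] that the inverse braiding makes of the
    left one.  In the same way the monoidal constraint of [X] and [Y] lets the coaction
    of [Y] act on [X] from the right ([Omega2E], [Omega_act_minus],
    [Omega_coact_minus]).  From these formulas follow the condition on
    Yetter-Drinfel'd modules over [B] ([dual_is_yd]), the compatibility of the
    constraint with actions and coactions, its coherence and its naturality.  A Hopf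
    algebra [K] is then sent to a Hopf algebra ([dual_yd_hopf]), as by any braided
    functor.

    The biproduct of [K] and [A] is a Hopf algebra ([biproduct_hopf]).  Its antipode is
    the product of the two antipodes, conjugated by the isomorphisms between [K ⊗ A]
    and [A ⊗ K] that come from the coaction and from the action, so it is invertible.
    The coinvariants of the projection to [A] are [K] because the projection turns the
    comultiplication into that of [A].  Applied to Omega(K), this proves everything
    about the partial dual.

    Applying Omega twice, the copairing of the first step cancels the pairing of the
    second.  The result is the object [X] with its action and coaction twisted by the
    squared antipode and the double braiding ([dual_yd_twice_act],
    [dual_yd_twice_coact]).  In Sweedler's notation and up to braidings,
    [theta x = S x_(-1) . x_(0)]; the condition on Yetter-Drinfel'd modules gives
    [S a_2 . theta (a_1 x) = eps a . theta x], hence [theta (a x) = S (S a) . theta x] and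
    the dual formula for the coaction.  So [theta] is a linear and colinear map from
    the twice dualized module to [X], and the twisted action yields its inverse.  The
    two constraints compose, up to braidings of [C], to the double braiding of
    Yetter-Drinfel'd modules.  As [theta] intertwines this double braiding with that
    of [C] ([yd_theta_monoidal]) and is natural, it is compatible with the product and
    the coproduct of [K], and [theta ⊗ id] is an isomorphism of biproducts
    ([yd_theta_biproduct]).

    All these identities are equations of string diagrams.  The first parts of the file
    contain a rewriting system for string diagrams in braided categories, proved sound
    ([diagram_sound]), and a search procedure that finds the rewriting steps.  A proof
    below consists of the list of the equations to be used; sliding nodes and strands
    past each other is left to the search. *)


Set Implicit Arguments.
Unset Strict Implicit.
Unset Printing Implicit Defensive.
Local Open Scope smc_scope.

(** * Arrows of a strict monoidal category *)
Section Strict.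
Variable C : strict_monoidal_category.
Implicit Types (X Y Z : Ob C) (f g h : Mor C).

Lemma hom_idm X : idm X ∈ X ⟶ X.
Proof. by rewrite dom_idm cod_idm. Qed.

Lemma hom_comp X Y Z f g : f ∈ X ⟶ Y -> g ∈ Y ⟶ Z -> g ∘ f ∈ X ⟶ Z.
Proof.
move=> [df cf] [dg cg]; rewrite dom_comp ?cod_comp ?cf ?dg //.
Qed.

Lemma hom_tens X Y X' Y' f g : f ∈ X ⟶ Y -> g ∈ X' ⟶ Y' ->
  f ⊗ g ∈ X ⊠ X' ⟶ Y ⊠ Y'.
Proof. by move=> [df cf] [dg cg]; rewrite dom_tens cod_tens df cf dg cg. Qed.

Lemma comp_idl X Y f : f ∈ X ⟶ Y -> idm Y ∘ f = f.
Proof. by move=> [_ <-]; rewrite comp_idm_l. Qed.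

Lemma comp_idr X Y f : f ∈ X ⟶ Y -> f ∘ idm X = f.
Proof. by move=> [<- _]; rewrite comp_idm_r. Qed.

Lemma compA X Y Z W f g h : f ∈ X ⟶ Y -> g ∈ Y ⟶ Z -> h ∈ Z ⟶ W ->
  h ∘ (g ∘ f) = h ∘ g ∘ f.
Proof. by move=> [_ cf] [dg cg] [dh _]; rewrite comp_assoc // ?cf ?dg ?cg ?dh. Qed.

Lemma tens_compE X Y Z X' Y' Z' f g f' g' :
  f ∈ X ⟶ Y -> g ∈ Y ⟶ Z -> f' ∈ X' ⟶ Y' -> g' ∈ Y' ⟶ Z' ->
  (g ⊗ g') ∘ (f ⊗ f') = (g ∘ f) ⊗ (g' ∘ f').
Proof.
by move=> [_ cf] [dg _] [_ cf'] [dg' _]; rewrite tens_comp ?cf ?dg ?cf' ?dg'.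
Qed.

Lemma inverse_unique X Y f g g' : f ∈ X ⟶ Y ->
  g ∈ Y ⟶ X -> g' ∈ Y ⟶ X -> g ∘ f = idm X -> f ∘ g' = idm Y -> g = g'.
Proof.
move=> hf hg hg' gf fg'.
by rewrite -(comp_idr hg) -fg' (compA hg' hf hg) gf (comp_idl hg').
Qed.

Lemma the_spec (P : Mor C -> Prop) : (exists f, P f) -> P (the P).
Proof. exact: ClassicalEpsilon.epsilon_spec. Qed.

Lemma inv_spec f : is_iso f -> is_inverse f (inv f).
Proof. exact: the_spec. Qed.

Lemma inv_eq X Y f g : f ∈ X ⟶ Y -> g ∈ Y ⟶ X ->
  g ∘ f = idm X -> f ∘ g = idm Y -> inv f = g.
Proof.
move=> hf hg gf fg; have [df cf] := hf.
have [hi [i1 i2]] : is_inverse f (inv f).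
  by apply: inv_spec; exists g; rewrite /is_inverse df cf.
rewrite df cf in hi i1 i2.
exact: (inverse_unique hf hi hg i1 fg).
Qed.

End Strict.

(** * String diagrams and their rewriting *)

(** A string diagram is cut into layers [(k, n)], the first of which is applied
    first: the node [n] acts on the strands from position [k] on, the other
    strands going straight through.  Strands carry natural numbers, standing for
    objects of the category.  [Cr x y] is the braiding from [x y] to [y x], and
    [Ci x y], of the same shape, is the inverse of the braiding [Cr y x]. *)
Inductive node := Box of nat | Cr of nat & nat | Ci of nat & nat.

Definition layer := (nat * node)%type.
Definition diag := seq layer.

Fixpoint eq_seq (l m : seq nat) : bool := match l, m with
  | [::], [::] => true
  | x :: l, y :: m => Nat.eqb x y && eq_seq l m
  | _, _ => false end.

Definition eq_node (m n : node) : bool := match m, n with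
  | Box i, Box j => Nat.eqb i j
  | Cr x y, Cr x' y' => Nat.eqb x x' && Nat.eqb y y'
  | Ci x y, Ci x' y' => Nat.eqb x x' && Nat.eqb y y'
  | _, _ => false end.

Fixpoint eq_diag (d e : diag) : bool := match d, e with
  | [::], [::] => true
  | (k, n) :: d, (k', n') :: e => [&& Nat.eqb k k', eq_node n n' & eq_diag d e]
  | _, _ => false end.

Lemma eqbP i j : Nat.eqb i j -> i = j.
Proof. by elim: i j => [|i IH] [|j] //= /IH ->. Qed.

Lemma eq_seqP l m : eq_seq l m -> l = m.
Proof. by elim: l m => [|x l IH] [|y m] //= /andP[/eqbP -> /IH ->]. Qed.

Lemma eq_nodeP m n : eq_node m n -> m = n.
Proof.
by case: m n => [i|x y|x y] [j|x' y'|x' y'] //= => [|/andP[]|/andP[]] /eqbP -> // /eqbP ->.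
Qed.

Lemma eq_diagP d e : eq_diag d e -> d = e.
Proof.
by elim: d e => [|[k n] d IH] [|[k' n'] e] //= /and3P[/eqbP -> /eq_nodeP -> /IH ->].
Qed.

Definition arity := (seq nat * seq nat)%type.

Section Typing.
Variable ar : seq arity.

Definition src (n : node) : seq nat := match n with
  | Box i => (nth ([::], [::]) ar i).1
  | Cr x y | Ci x y => [:: x; y] end.

Definition tgt (n : node) : seq nat := match n with
  | Box i => (nth ([::], [::]) ar i).2
  | Cr x y | Ci x y => [:: y; x] end.

Definition exec (l : seq nat) (y : layer) : option (seq nat) :=
  let: (k, n) := y in
  let s := src n in
  let r := drop k l in
  if (k <= size l)%N && eq_seq (take (size s) r) s
  then Some (take k l ++ tgt n ++ drop (size s) r) else None.
Arguments exec : simpl never.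

Fixpoint run (l : seq nat) (d : diag) : option (seq nat) := match d with
  | [::] => Some l
  | y :: d => if exec l y is Some m then run m d else None end.

Lemma execP l k n m : exec l (k, n) = Some m ->
  exists p q, [/\ k = size p, l = p ++ src n ++ q & m = p ++ tgt n ++ q].
Proof.
rewrite /exec; case: ifP => // /andP[kl /eq_seqP e] [<-].
exists (take k l), (drop (size (src n)) (drop k l)); split=> //.
  by rewrite size_takel.
by rewrite -{1}e cat_take_drop cat_take_drop.
Qed.

Lemma eq_seq_refl l : eq_seq l l.
Proof. by elim: l => //= x l ->; rewrite andbT; elim: x. Qed.

Lemma exec_cat p q n : exec (p ++ src n ++ q) (size p, n) = Some (p ++ tgt n ++ q).
Proof.
rewrite /exec drop_size_cat // take_size_cat // take_size_cat // drop_size_cat //.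
by rewrite eq_seq_refl size_cat leq_addr.
Qed.

Lemma run_cat l d e : run l (d ++ e) = if run l d is Some m then run m e else None.
Proof. by elim: d l => //= y d IH l; case: (exec l y). Qed.

Definition shift (k : nat) (d : diag) : diag := [seq (addn k y.1, y.2) | y <- d].

Lemma shift0 d : shift 0 d = d.
Proof. by elim: d => //= -[k n] d ->. Qed.

Lemma run_shift p q l d m : run l d = Some m ->
  run (p ++ l ++ q) (shift (size p) d) = Some (p ++ m ++ q).
Proof.
elim: d l => /= [l [->]//|[k n] d IH l].
case E: (exec l (k, n)) => [l'|//] /IH <-.
have [p' [q' [-> -> ->]]] := execP E => /=.
have -> : (addn (size p) (size p'), n) = (size (p ++ p'), n) by rewrite size_cat.
by rewrite -!catA catA exec_cat /= -!catA.
Qed.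

(** The braiding of one object with a tensor product, decomposed by the hexagon
    axioms into crossings of two strands; [X] is [Cr] or [Ci]. *)
Fixpoint pass_right (X : nat -> nat -> node) (z : nat) (s : seq nat) : diag :=
  if s is x :: s then (0, X z x) :: shift 1 (pass_right X z s) else [::].

Fixpoint crosses (X : nat -> nat -> node) (l s : seq nat) : diag :=
  if l is z :: l then shift 1 (crosses X l s) ++ pass_right X z s else [::].

(** The equations that hold in all braided categories: the interchange law for two
    nodes separated by the strands [g], the naturality of the braiding, and its
    invertibility.  In [Nat l b n z] the strand [z] moves across the node [n], from
    the left of [n] if [l] holds, through crossings of sign [b].  The hexagon axioms
    are absorbed in the decomposition of braidings into crossings, and the
    Yang-Baxter equation is the case of [Nat] where [n] is a crossing. *)
Inductive srule :=
  | Exch of node & seq nat & node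
  | Nat of bool & bool & node & nat
  | Canc of bool & nat & nat.

Definition rule := (seq nat * diag * diag)%type.

Definition crossing (b : bool) := if b then Cr else Ci.

Definition srule_rule (r : srule) : rule := match r with
  | Exch m g n => (src m ++ g ++ src n,
      [:: (0, m); (size (tgt m) + size g, n)],
      [:: (size (src m) + size g, n); (0, m)])%N
  | Nat true b n z => (z :: src n,
      pass_right (crossing b) z (src n) ++ [:: (0, n)],
      (1, n) :: pass_right (crossing b) z (tgt n))
  | Nat false b n z => (rcons (src n) z,
      rcons (crosses (crossing b) (src n) [:: z]) (1, n),
      (0, n) :: crosses (crossing b) (tgt n) [:: z])
  | Canc b x y =>
      ([:: x; y], [:: (0, crossing b x y); (0, crossing (~~ b) y x)], [::])
  end.

(** [Move r b i k] rewrites with the rule [r], backwards if [b] is false, from the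
    layer [i] and the strand [k] on; [inl j] is the [j]-th of the given equations. *)
Inductive move := Move of (nat + srule) & bool & nat & nat.

Definition apply_rule (l : seq nat) (r : rule) (i k : nat) (d : diag) : option diag :=
  let: (xs, L, R) := r in
  let pre := take i d in
  let rest := drop i d in
  if run l pre is Some m then
    if [&& (k <= size m)%N, eq_seq (take (size xs) (drop k m)) xs &
           eq_diag (take (size L) rest) (shift k L)]
    then Some (pre ++ shift k R ++ drop (size L) rest) else None
  else None.

Definition flip (r : rule) : rule := let: (xs, L, R) := r in (xs, R, L).

Definition move_rule (us : seq rule) (mv : nat + srule) (b : bool) : rule :=
  let r := match mv with
    | inl j => nth ([::], [::], [::]) us j | inr s => srule_rule s end in
  if b then r else flip r.

Fixpoint play (us : seq rule) (l : seq nat) (ms : seq move) (d : diag) : option diag :=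
  match ms with
  | [::] => Some d
  | Move mv b i k :: ms =>
      if apply_rule l (move_rule us mv b) i k d is Some d' then play us l ms d'
      else None
  end.

End Typing.
Arguments exec : simpl never.

(** * Denotations *)
Section Denotation.
Variable C : braided_category.
Variable ob : nat -> Ob C.

Fixpoint obs (l : seq nat) : Ob C :=
  if l is x :: l then ob x ⊠ obs l else unitO.

Lemma obs_cat l m : obs (l ++ m) = obs l ⊠ obs m.
Proof.
by elim: l => [|x l IH] /=; rewrite ?tensO_unit_l // IH tensO_assoc.
Qed.

Lemma obs1 x : obs [:: x] = ob x.
Proof. by rewrite /= tensO_unit_r. Qed.

Variable ar : seq arity.
Variable arr : nat -> Mor C.
Hypothesis arr_hom : forall i,
  arr i ∈ obs (nth ([::], [::]) ar i).1 ⟶ obs (nth ([::], [::]) ar i).2.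

Local Notation src := (src ar).
Local Notation tgt := (tgt ar).
Local Notation exec := (exec ar).
Local Notation run := (run ar).

Definition den_node (n : node) : Mor C := match n with
  | Box i => arr i
  | Cr x y => br (ob x) (ob y)
  | Ci x y => inv (br (ob y) (ob x)) end.

Lemma inv_br_spec (X Y : Ob C) : [/\ inv (br X Y) ∈ Y ⊠ X ⟶ X ⊠ Y,
  inv (br X Y) ∘ br X Y = idm (X ⊠ Y) & br X Y ∘ inv (br X Y) = idm (Y ⊠ X)].
Proof.
have [h [h1 h2]] := inv_spec (br_iso X Y); have [d c] := br_hom X Y.
by rewrite d c in h h1 h2; split.
Qed.

Lemma den_node_hom n : den_node n ∈ obs (src n) ⟶ obs (tgt n).
Proof.
case: n => [i|x y|x y] /=; rewrite ?tensO_unit_r; first exact: arr_hom.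
  exact: br_hom.
by have [] := inv_br_spec (ob y) (ob x).
Qed.

Definition den_layer (l : seq nat) (y : layer) : Mor C :=
  let: (k, n) := y in
  idm (obs (take k l)) ⊗ den_node n ⊗ idm (obs (drop (size (src n)) (drop k l))).

(* A value is needed for ill-typed diagrams; [run] excludes them below. *)
Fixpoint den (l : seq nat) (d : diag) : Mor C := match d with
  | [::] => idm (obs l)
  | y :: d => if exec l y is Some m then den m d ∘ den_layer l y
              else idm unitO end.

Arguments den_layer : simpl never.

Lemma den_layer_cat p q n : den_layer (p ++ src n ++ q) (size p, n) =
  idm (obs p) ⊗ den_node n ⊗ idm (obs q).
Proof.
by rewrite /den_layer take_size_cat // drop_size_cat // drop_size_cat.
Qed.

Lemma den_layer_hom l y m : exec l y = Some m -> den_layer l y ∈ obs l ⟶ obs m.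
Proof.
case: y => k n /execP[p [q [-> -> ->]]]; rewrite den_layer_cat !obs_cat.
by do 2![apply: hom_tens; first by [exact: hom_idm | exact: den_node_hom]]; exact: hom_idm.
Qed.

Lemma den_hom l d m : run l d = Some m -> den l d ∈ obs l ⟶ obs m.
Proof.
elim: d l => /= [l [->]|y d IH l]; first exact: hom_idm.
case E: (exec l y) => [l'|//] /IH; apply: hom_comp; exact: den_layer_hom.
Qed.

Lemma den_cat l d e m k : run l d = Some m -> run m e = Some k ->
  den l (d ++ e) = den m e ∘ den l d.
Proof.
elim: d l => /= [l [->]|y d IH l]; first by move=> /den_hom/comp_idr ->.
case E: (exec l y) => [l'|//] hd he.
rewrite (IH _ hd he) -(compA (den_layer_hom E) (den_hom hd) (den_hom he)) //.
Qed.

Lemma den_shift p q l d m : run l d = Some m ->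
  den (p ++ l ++ q) (shift (size p) d) = idm (obs p) ⊗ den l d ⊗ idm (obs q).
Proof.
elim: d l => /= [l _|[k n] d IH l]; first by rewrite !tens_idm !obs_cat.
case E: (exec l (k, n)) => [l'|//] hd.
have [p' [q' [ek el el']]] := execP E; subst.
have -> : (addn (size p) (size p'), n) = (size (p ++ p'), n) by rewrite size_cat.
have E1 : p ++ (p' ++ src n ++ q') ++ q = (p ++ p') ++ src n ++ (q' ++ q) by rewrite -!catA.
have E2 : p ++ (p' ++ tgt n ++ q') ++ q = (p ++ p') ++ tgt n ++ (q' ++ q) by rewrite -!catA.
rewrite E1 exec_cat den_layer_cat -E2 (IH _ hd) den_layer_cat.
rewrite !obs_cat -!tens_idm -!tens_assoc.
have hn := den_node_hom n; have hi (X : Ob C) := hom_idm X.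
have hL : idm (obs p') ⊗ den_node n ⊗ idm (obs q') ∈ obs (p' ++ src n ++ q') ⟶ obs (p' ++ tgt n ++ q').
  by rewrite !obs_cat; do !apply: hom_tens.
have hD := den_hom hd.
have -> : idm (obs p) ⊗ idm (obs p') ⊗ den_node n ⊗ idm (obs q') ⊗ idm (obs q)
   = idm (obs p) ⊗ (idm (obs p') ⊗ den_node n ⊗ idm (obs q')) ⊗ idm (obs q) by rewrite -!tens_assoc.
rewrite (tens_compE (hi _) (hi _) (hom_tens hL (hi _)) (hom_tens hD (hi _))).
by rewrite (tens_compE hL hD (hi _) (hi _)) !(comp_idl (hi _)).
Qed.

Definition valid (r : rule) : Prop := let: (xs, L, R) := r in
  exists ys, [/\ run xs L = Some ys, run xs R = Some ys & den xs L = den xs R].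

Lemma valid_flip r : valid r -> valid (flip r).
Proof. by case: r => [[xs L] R] /= [ys [h1 h2 h3]]; exists ys; split. Qed.

(** A rule may be applied inside a diagram because [den] turns concatenation into
    composition and [shift] into tensoring with identities. *)
Lemma apply_rule_sound l r i k d d' m : valid r ->
  apply_rule ar l r i k d = Some d' -> run l d = Some m ->
  run l d' = Some m /\ den l d = den l d'.
Proof.
case: r => [[xs L] R] [ys [hL hR hLR]]; rewrite /apply_rule.
case E: (run l (take i d)) => [w|//]; case: ifP => // /and3P[kw /eq_seqP exs /eq_diagP eL] [<-].
have : d = take i d ++ shift k L ++ drop (size L) (drop i d).
  by rewrite -eL !cat_take_drop.
move: E; move: (take i d) (drop (size L) (drop i d)) => pre post E ed.
have ek : k = size (take k w) by rewrite size_takel.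
have ew : w = take k w ++ xs ++ drop (size xs) (drop k w).
  by rewrite -{1}exs cat_take_drop cat_take_drop.
move: ek ew; move: (take k w) (drop (size xs) (drop k w)) => p q ek ew.
rewrite {}ed {}ek {eL}.
rewrite {}ew in E.
rewrite !run_cat E /= !run_cat (run_shift p q hL) (run_shift p q hR) => hm; split=> //.
have hpL : run (p ++ xs ++ q) (shift (size p) L ++ post) = Some m.
  by rewrite run_cat (run_shift p q hL).
have hpR : run (p ++ xs ++ q) (shift (size p) R ++ post) = Some m.
  by rewrite run_cat (run_shift p q hR).
rewrite (den_cat E hpL) (den_cat E hpR).
rewrite (den_cat (run_shift p q hL) hm) (den_cat (run_shift p q hR) hm).
by rewrite (den_shift p q hL) (den_shift p q hR) hLR.
Qed.

(** The two signs of a crossing are treated alike below: the inverse braiding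
    satisfies the same axioms as the braiding. *)
Definition xing (b : bool) (X Y : Ob C) : Mor C := if b then br X Y else inv (br Y X).

Lemma xing_hom b X Y : xing b X Y ∈ X ⊠ Y ⟶ Y ⊠ X.
Proof. by case: b; [exact: br_hom|have [] := inv_br_spec Y X]. Qed.

Lemma xing_canc b X Y : xing (~~ b) Y X ∘ xing b X Y = idm (X ⊠ Y).
Proof. by case: b; [have [] := inv_br_spec X Y|have [] := inv_br_spec Y X]. Qed.

Lemma xing_natural b X Y X' Y' f g : f ∈ X ⟶ X' -> g ∈ Y ⟶ Y' ->
  xing b X' Y' ∘ (f ⊗ g) = (g ⊗ f) ∘ xing b X Y.
Proof.
move=> hf hg; have hfg := hom_tens hf hg; have hgf := hom_tens hg hf.
case: b.
  by have := br_natural f g; have [-> ->] := hf; have [-> ->] := hg.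
have := br_natural g f; have [-> ->] := hf; have [-> ->] := hg => e.
have hx := xing_hom false X Y; have hx' := xing_hom false X' Y'.
have hb := xing_hom true Y X; have hb' := xing_hom true Y' X'.
have h1 := xing_canc true Y' X'; have h2 := xing_canc false X Y.
rewrite /= in hx hx' hb hb' h1 h2 *.
rewrite -[LHS](comp_idr (hom_comp hfg hx')) -h2.
rewrite (compA hx hb (hom_comp hfg hx')) -(compA hb hfg hx') -e.
by rewrite (compA hgf hb' hx') h1 (comp_idl hgf).
Qed.

Lemma xing_tens_r b X Y Z :
  xing b X (Y ⊠ Z) = (idm Y ⊗ xing b X Z) ∘ (xing b X Y ⊗ idm Z).
Proof.
case: b; first exact: br_hexagon_r.
have hi W := @hom_idm C W; rewrite /=.
have hXY := xing_hom true Y X; have hXZ := xing_hom true Z X.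
have hYX := xing_hom false X Y; have hZX := xing_hom false X Z.
have a1 := xing_canc true Y X; have a2 := xing_canc true Z X.
have a3 := xing_canc false X Y; have a4 := xing_canc false X Z.
rewrite /= in hXY hXZ hYX hZX a1 a2 a3 a4.
have h1 := hom_tens hXY (hi Z); have h2 := hom_tens (hi Y) hXZ.
have h3 := hom_tens hYX (hi Z); have h4 := hom_tens (hi Y) hZX.
rewrite -!tensO_assoc in h1 h2 h3 h4.
apply: (inv_eq (br_hom (Y ⊠ Z) X)).
- by rewrite -!tensO_assoc; exact: hom_comp h3 h4.
- rewrite br_hexagon_l (compA h2 h1 (hom_comp h3 h4)) -(compA h1 h3 h4).
  rewrite (tens_compE hXY hYX (hi _) (hi _)) a1 (comp_idl (hi _)) tens_idm.
  rewrite -tensO_assoc (comp_idr h4).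
  by rewrite (tens_compE (hi _) (hi _) hXZ hZX) a2 (comp_idl (hi _)) tens_idm tensO_assoc.
- rewrite br_hexagon_l (compA h3 h4 (hom_comp h2 h1)) -(compA h4 h2 h1).
  rewrite (tens_compE (hi _) (hi _) hZX hXZ) a4 (comp_idl (hi _)) tens_idm.
  rewrite ?(comp_idr h1).
  by rewrite (tens_compE hYX hXY (hi _) (hi _)) a3 (comp_idl (hi _)) tens_idm -tensO_assoc.
Qed.

Lemma xing_tens_l b X Y Z :
  xing b (X ⊠ Y) Z = (xing b X Z ⊗ idm Y) ∘ (idm X ⊗ xing b Y Z).
Proof.
case: b; first exact: br_hexagon_l.
have hi W := @hom_idm C W; rewrite /=.
have hXZ := xing_hom true Z X; have hYZ := xing_hom true Z Y.
have hZX := xing_hom false X Z; have hZY := xing_hom false Y Z.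
have a1 := xing_canc true Z X; have a2 := xing_canc true Z Y.
have a3 := xing_canc false X Z; have a4 := xing_canc false Y Z.
rewrite /= in hXZ hYZ hZX hZY a1 a2 a3 a4.
have h1 := hom_tens hXZ (hi Y); have h2 := hom_tens (hi X) hYZ.
have h3 := hom_tens hZX (hi Y); have h4 := hom_tens (hi X) hZY.
rewrite -!tensO_assoc in h1 h2 h3 h4.
apply: (inv_eq (br_hom Z (X ⊠ Y))).
- by rewrite -!tensO_assoc; exact: hom_comp h4 h3.
- rewrite br_hexagon_r (compA h1 h2 (hom_comp h4 h3)) -(compA h2 h4 h3).
  rewrite (tens_compE (hi _) (hi _) hYZ hZY) a2 (comp_idl (hi _)) tens_idm.
  rewrite -?tensO_assoc (comp_idr h3).
  by rewrite (tens_compE hXZ hZX (hi _) (hi _)) a1 (comp_idl (hi _)) tens_idm -tensO_assoc.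
- rewrite br_hexagon_r (compA h4 h3 (hom_comp h1 h2)) -(compA h3 h1 h2).
  rewrite (tens_compE hZX hXZ (hi _) (hi _)) a3 (comp_idl (hi _)) tens_idm.
  rewrite -tensO_assoc (comp_idr h2).
  by rewrite (tens_compE (hi _) (hi _) hZY hYZ) a4 (comp_idl (hi _)) tens_idm tensO_assoc.
Qed.

(** By the hexagon axiom this crossing is idempotent, and it is invertible. *)
Lemma xing_unit_r b X : xing b X unitO = idm X.
Proof.
have := xing_tens_r b X unitO unitO.
have h := xing_hom b X unitO; have hi := xing_hom (~~ b) unitO X.
have e := xing_canc b X unitO.
rewrite tensO_unit_l tensO_unit_r in h hi e.
rewrite tensO_unit_l tens_unit_l tens_unit_r => e'.
by rewrite -(comp_idl h) -{1}e -(compA h h hi) -e' e.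
Qed.

Lemma xing_unit_l b X : xing b unitO X = idm X.
Proof.
have := xing_tens_l b unitO unitO X.
have h := xing_hom b unitO X; have hi := xing_hom (~~ b) X unitO.
have e := xing_canc b unitO X.
rewrite tensO_unit_l tensO_unit_r in h hi e.
rewrite tensO_unit_l tens_unit_l tens_unit_r => e'.
by rewrite -(comp_idl h) -{1}e -(compA h h hi) -e' e.
Qed.

Lemma den_crossing b x y : den_node (crossing b x y) = xing b (ob x) (ob y).
Proof. by case: b. Qed.

Lemma src_crossing b x y : src (crossing b x y) = [:: x; y].
Proof. by case: b. Qed.

Lemma tgt_crossing b x y : tgt (crossing b x y) = [:: y; x].
Proof. by case: b. Qed.

Lemma den_cons l y d m : exec l y = Some m ->
  run l (y :: d) = run m d /\ den l (y :: d) = den m d ∘ den_layer l y.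
Proof. by move=> /= ->. Qed.

Lemma den_rcons l y d m k : run l d = Some m -> exec m y = Some k ->
  run l (rcons d y) = Some k /\ den l (rcons d y) = den_layer m y ∘ den l d.
Proof.
move=> hd hy; have hy1 : run m [:: y] = Some k by rewrite /= hy.
rewrite -cats1 run_cat hd; split=> //.
by rewrite (den_cat hd hy1) /= hy (comp_idl (den_layer_hom hy)).
Qed.

Lemma den_two l y y' m k : exec l y = Some m -> exec m y' = Some k ->
  run l [:: y; y'] = Some k /\ den l [:: y; y'] = den_layer m y' ∘ den_layer l y.
Proof. by move=> /= -> h; rewrite h (comp_idl (den_layer_hom h)). Qed.

Lemma den_pass_right b z s :
  run (z :: s) (pass_right (crossing b) z s) = Some (rcons s z) /\
  den (z :: s) (pass_right (crossing b) z s) = xing b (ob z) (obs s).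
Proof.
elim: s => [|x s [IH1 IH2]] /=; first by rewrite xing_unit_r tensO_unit_r.
have := exec_cat ar [::] s (crossing b z x).
have := den_layer_cat [::] s (crossing b z x).
rewrite src_crossing tgt_crossing /= => -> ->.
have h1 := run_shift [:: x] [::] IH1; have h2 := den_shift [:: x] [::] IH1.
rewrite /= !cats0 in h1 h2; split=> //.
rewrite h2 IH2 xing_tens_r den_crossing tens_unit_r tensO_unit_r tens_unit_l //.
Qed.

Lemma den_crosses b l s :
  run (l ++ s) (crosses (crossing b) l s) = Some (s ++ l) /\
  den (l ++ s) (crosses (crossing b) l s) = xing b (obs l) (obs s).
Proof.
elim: l => [|z l [IH1 IH2]] /=; first by rewrite cats0 xing_unit_l.
have := run_shift [:: z] [::] IH1; have := den_shift [:: z] [::] IH1.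
rewrite /= !cats0 => h2 h1.
have [p1 p2] := den_pass_right b z s.
have := run_shift [::] l p1; have := den_shift [::] l p1.
rewrite /= shift0 => h4 h3; rewrite run_cat h1 h3 cat_rcons; split=> //.
rewrite (den_cat h1 h3) h2 h4 IH2 p2 xing_tens_l.
by rewrite tens_unit_l tens_unit_r tensO_unit_r.
Qed.

Lemma valid_exch m g n : valid (srule_rule ar (Exch m g n)).
Proof.
exists (tgt m ++ g ++ tgt n).
have hm := den_node_hom m; have hn := den_node_hom n; have hi W := @hom_idm C W.
have a1 := exec_cat ar [::] (g ++ src n) m; have a2 := den_layer_cat [::] (g ++ src n) m.
have b1 := exec_cat ar (tgt m ++ g) [::] n; have b2 := den_layer_cat (tgt m ++ g) [::] n.
have c1 := exec_cat ar (src m ++ g) [::] n; have c2 := den_layer_cat (src m ++ g) [::] n.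
have d1 := exec_cat ar [::] (g ++ tgt n) m; have d2 := den_layer_cat [::] (g ++ tgt n) m.
rewrite ?cats0 -?catA ?size_cat ?cat0s in a1 a2 b1 b2 c1 c2 d1 d2.
have [e1 e2] := den_two a1 b1; have [f1 f2] := den_two c1 d1.
rewrite /srule_rule; split=> //; rewrite [LHS]e2 [RHS]f2.
rewrite a2 b2 c2 d2 !obs_cat !tens_unit_r !tens_unit_l -!tens_idm.
have X1 := tens_compE hm (hi _) (hi (obs g ⊠ obs (src n))) (hom_tens (hi (obs g)) hn).
have X2 := tens_compE (hi _) hm (hom_tens (hi (obs g)) hn) (hi (obs g ⊠ obs (tgt n))).
rewrite -!tens_idm -!tens_assoc in X1 X2 *; rewrite X1 X2.
rewrite !tens_idm (comp_idl hm) (comp_idr hm).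
by rewrite (comp_idl (hom_tens (hi _) hn)) (comp_idr (hom_tens (hi _) hn)).
Qed.

Lemma valid_canc b x y : valid (srule_rule ar (Canc b x y)).
Proof.
exists [:: x; y].
have a1 := exec_cat ar [::] [::] (crossing b x y).
have a2 := den_layer_cat [::] [::] (crossing b x y).
have b1 := exec_cat ar [::] [::] (crossing (~~ b) y x).
have b2 := den_layer_cat [::] [::] (crossing (~~ b) y x).
rewrite !cats0 !cat0s !src_crossing !tgt_crossing in a1 a2 b1 b2.
have [e1 e2] := den_two a1 b1; split=> //.
rewrite [LHS]e2 a2 b2 /= !tens_unit_r !tens_unit_l !den_crossing xing_canc.
by rewrite tensO_unit_r.
Qed.

Lemma valid_nat l b n z : valid (srule_rule ar (Nat l b n z)).
Proof.
have hn := den_node_hom n; have hi W := @hom_idm C W.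
have p1 := exec_cat ar [::] [:: z] n; have p2 := den_layer_cat [::] [:: z] n.
have q1 := exec_cat ar [:: z] [::] n; have q2 := den_layer_cat [:: z] [::] n.
rewrite !cats0 !cat0s !cats1 !cat1s in p1 p2 q1 q2.
case: l; rewrite /srule_rule.
- exists (rcons (tgt n) z).
  have [a1 a2] := den_pass_right b z (src n).
  have [d1 d2] := den_pass_right b z (tgt n).
  have [e1 e2] := den_rcons a1 p1; have [f1 f2] := den_cons (pass_right (crossing b) z (tgt n)) q1.
  rewrite cats1 e1 f1 d1 e2 f2; split=> //.
  rewrite p2 q2 a2 d2 obs1 !tens_unit_r !tens_unit_l.
  by rewrite (xing_natural b (hi _) hn).
- exists (z :: tgt n).
  have [a1 a2] := den_crosses b (src n) [:: z].
  have [d1 d2] := den_crosses b (tgt n) [:: z].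
  rewrite !cats1 in a1 a2 d1 d2.
  have [e1 e2] := den_rcons a1 q1; have [f1 f2] := den_cons (crosses (crossing b) (tgt n) [:: z]) p1.
  rewrite e1 f1 d1 e2 f2; split=> //.
  rewrite p2 q2 a2 d2 obs1 !tens_unit_r !tens_unit_l.
  by rewrite (xing_natural b hn (hi _)).
Qed.

Lemma valid_srule r : valid (srule_rule ar r).
Proof. by case: r => *; [exact: valid_exch | exact: valid_nat | exact: valid_canc]. Qed.

Fixpoint all_valid (us : seq rule) : Prop :=
  if us is u :: us then valid u /\ all_valid us else True.

Lemma all_valid_nth us j : all_valid us -> valid (nth ([::], [::], [::]) us j).
Proof.
have v0 : valid ([::], [::], [::]) by exists [::].
by elim: us j => [|u us IH] [|j] //= [hu hus] //; exact: IH.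
Qed.

(** Any list of moves that can be played is a proof of an equation, wherever the
    list comes from. *)
Lemma play_sound us l ms d d' m : all_valid us ->
  play ar us l ms d = Some d' -> run l d = Some m ->
  run l d' = Some m /\ den l d = den l d'.
Proof.
move=> hus; elim: ms d => /= [d [->]//|[mv b i k] ms IH d].
case E: (apply_rule _ _ _ _ _ _) => [e|//] he hd.
have v : valid (move_rule ar us mv b).
  rewrite /move_rule; case: b {E}; last apply: valid_flip.
    by case: mv => [j|s]; [exact: all_valid_nth | exact: valid_srule].
  by case: mv => [j|s]; [exact: all_valid_nth | exact: valid_srule].
have [h1 ->] := apply_rule_sound v E hd.
exact: IH.
Qed.

End Denotation.

(** * Search for rewriting sequences *)

(** The functions of this part propose lists of moves.  Nothing is proved about
    them: [play_sound] certifies whatever list they return, so an error here can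
    only make a proof fail.  The strategy is to keep diagrams in a normal form with
    respect to the equations of braided categories, to look for the left side of
    the next equation as a subgraph, up to interchange, and to bring its nodes
    together.  When there is no occurrence, neighbouring isotopic diagrams are
    tried. *)
Section Search.
Variable ar : seq arity.
Local Notation src := (src ar).
Local Notation tgt := (tgt ar).

(** A layer with the word of strands below it. *)
Definition alayer := (seq nat * layer)%type.
Definition state := seq alayer.

Fixpoint annot (l : seq nat) (d : diag) : state := match d with
  | [::] => [::]
  | y :: d => (l, y) :: (if exec ar l y is Some m then annot m d else [::]) end.

Definition plain (s : state) : diag := map snd s.

Definition slice (l : seq nat) (p q : nat) := take (subn q p) (drop p l).

(** Interchange of the layers [a] and [b], of indices [i] and [i + 1]. *)
Definition swap (i : nat) (a b : alayer) : option (move * alayer * alayer) :=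
  let: (wa, (ka, na)) := a in
  let: (wb, (kb, nb)) := b in
  let sa := size (src na) in let ta := size (tgt na) in
  let sb := size (src nb) in let tb := size (tgt nb) in
  if Nat.leb (ka + ta) kb then
    let kb' := subn (kb + sa) ta in
    let w' := take kb' wa ++ tgt nb ++ drop (kb' + sb) wa in
    Some (Move (inr (Exch na (slice wb (ka + ta) kb) nb)) true i ka,
          (wa, (kb', nb)), (w', (ka, na)))
  else if Nat.leb (kb + sb) ka then
    let w' := take kb wa ++ tgt nb ++ drop (kb + sb) wa in
    Some (Move (inr (Exch nb (slice wa (kb + sb) ka) na)) false i kb,
          (wa, (kb, nb)), (w', (subn (ka + tb) sb, na)))
  else None.

(* A node without outputs below a node without inputs can pass it on both sides, so
   it stays below, from whichever side it came; this is the second clause. *)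
Definition left_of (a b : alayer) : bool :=
  let: (wa, (ka, na)) := a in
  let: (wb, (kb, nb)) := b in
  (Nat.leb (kb + size (src nb)) ka && ~~ Nat.leb (ka + size (tgt na)) kb)
  || [&& Nat.eqb (size (src na)) 0, Nat.eqb (size (tgt nb)) 0 & Nat.leb (ka + size (tgt na)) kb].

(* [p] is the reversed list of the [n] layers before [x]; [x] goes down while it is on
   the left of the preceding layer.  Lists of moves are reversed from here on. *)
Fixpoint insl (p : state) (n : nat) (x : alayer) (acc : state) (ms : seq move) : state * seq move :=
  match p with
  | [::] => (x :: acc, ms)
  | a :: p' => if left_of a x then
      match swap n.-1 a x with
      | Some (m, x', a') => insl p' n.-1 x' (a' :: acc) (m :: ms)
      | None => (rev p ++ x :: acc, ms) end
      else (rev p ++ x :: acc, ms) end.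

Fixpoint canon_pass (p : state) (s : state) (ms : seq move) : state * seq move :=
  match s with
  | [::] => (p, ms)
  | x :: s => let: (p', ms') := insl (rev p) (size p) x [::] ms in canon_pass p' s ms' end.

(** Normal form for the interchange law, by insertion sort. *)
Fixpoint canon (fuel : nat) (s : state) (ms : seq move) : state * seq move :=
  match fuel with 0 => (s, ms) | fuel.+1 =>
    let: (s', ms') := canon_pass [::] s ms in
    if Nat.eqb (size ms') (size ms) then (s', ms') else canon fuel s' ms' end.

(** The graph of a diagram forgets the heights of the nodes: each node comes with
    the names of its input and output wires. *)
Definition gnode := (node * seq nat * seq nat)%type.
Fixpoint graph_ (ws : seq nat) (fresh : nat) (d : diag) : seq gnode := match d with
  | [::] => [::]
  | (k, n) :: d =>
      let t := size (tgt n) in let sn := size (src n) in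
      let ins := take sn (drop k ws) in
      let outs := iota fresh t in
      (n, ins, outs) :: graph_ (take k ws ++ outs ++ drop (k + sn) ws) (fresh + t) d end.
Definition graph (nin : nat) (d : diag) := graph_ (iota 0 nin) nin d.

Fixpoint lookup (x : nat) (m : seq (nat * nat)) : option nat := match m with
  | [::] => None | (a, b) :: m => if Nat.eqb a x then Some b else lookup x m end.
Fixpoint rlookup (x : nat) (m : seq (nat * nat)) : option nat := match m with
  | [::] => None | (a, b) :: m => if Nat.eqb b x then Some a else rlookup x m end.

Fixpoint bind_all (ps ws : seq nat) (m : seq (nat * nat)) : option (seq (nat * nat)) :=
  match ps, ws with
  | [::], [::] => Some m
  | p :: ps, w :: ws =>
     match lookup p m, rlookup w m with
     | Some w', _ => if Nat.eqb w w' then bind_all ps ws m else None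
     | None, None => bind_all ps ws ((p, w) :: m)
     | None, Some _ => None end
  | _, _ => None end.

Fixpoint memb (x : nat) (l : seq nat) := if l is y :: l then Nat.eqb x y || memb x l else false.

(** The occurrences of the graph [pat] in the graph [g], as lists of indices of
    layers; [m] is the injective matching of wires built so far. *)
Fixpoint find_all (g pat : seq gnode) (m : seq (nat * nat)) (used : seq nat)
    : seq (seq nat) :=
  match pat with
  | [::] => [:: rev used]
  | (n, pi, po) :: pat =>
     (fix F (i : nat) (h : seq gnode) := match h with
      | [::] => [::]
      | (n', wi, wo) :: h =>
         (if eq_node n n' then
           if memb i used then [::] else
           if bind_all pi wi m is Some m1 then
             if bind_all po wo m1 is Some m2 then find_all g pat m2 (i :: used) else [::]
           else [::]
         else [::]) ++ F i.+1 h end) 0 g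
  end.

(** A layer, with its index in the pattern if it belongs to the occurrence. *)
Definition tagged := (option nat * alayer)%type.

(* The layer [x], of index [n], goes down through the reversed list [p] as long as [c]
   holds of the tags. *)
Fixpoint pull (c : option nat -> bool) (p : seq tagged) (n : nat) (x : alayer)
  (acc : seq tagged) (ms : seq move) : option (alayer * seq tagged * seq tagged * seq move) :=
  match p with
  | [::] => Some (x, [::], acc, ms)
  | (t, a) :: p' => if c t then
      match swap n.-1 a x with
      | Some (m, x', a') => pull c p' n.-1 x' ((t, a') :: acc) (m :: ms)
      | None => None end
      else Some (x, rev p, acc, ms) end.

Fixpoint index_of (x : nat) (l : seq nat) : option nat :=
  if l is y :: l then if Nat.eqb x y then Some 0 else omap S (index_of x l) else None.

Definition after_tag (j : nat) (t : option nat) : bool :=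
  if t is Some j' then Nat.ltb j j' else true.

(** Makes the layers with indices in [I] adjacent, in the order of [I].  The layers
    between them go below the block when interchange allows it, and else above. *)
Fixpoint gather (i : nat) (I : seq nat) (s : state)
  (before : state) (blk after : seq tagged) (ms : seq move)
  : option (state * state * state * seq move) :=
  match s with
  | [::] => Some (before, map snd blk, map snd after, ms)
  | x :: s =>
     let n := size before + size blk + size after in
     match index_of i I with
     | Some j =>
         match pull (after_tag j) (rev (blk ++ after)) n x [::] ms with
         | Some (x', p, q, ms') =>
             let ba := p ++ (Some j, x') :: q in
             gather i.+1 I s before (take (size blk).+1 ba) (drop (size blk).+1 ba) ms'
         | None => None end
     | None =>
        if blk is [::] then gather i.+1 I s (before ++ [:: x]) blk after ms else
        match pull (fun _ => true) (rev (blk ++ after)) n x [::] ms with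
         | Some (x', _, ba, ms') =>
             gather i.+1 I s (before ++ [:: x']) (take (size blk) ba) (drop (size blk) ba) ms'
         | None => gather i.+1 I s before blk (after ++ [:: (None, x)]) ms end
     end
  end.

(** A rewriting rule; [p_emit i k] is the reversed list of moves that performs it at
    the layer [i] and the strand [k]. *)
Record pattern := Pattern {
  p_in : seq nat; p_lhs : diag; p_rhs : diag; p_emit : nat -> nat -> seq move }.

Definition pat_of (r : rule) (mv : nat + srule) (b : bool) : pattern :=
  let: (xs, L, R) := if b then r else flip r in
  Pattern xs L R (fun i k => [:: Move mv b i k]).

Definition srule_pat (r : srule) (b : bool) : pattern := pat_of (srule_rule ar r) (inr r) b.

Definition sm := (state * seq move)%type.

Definition rewrite_at (l0 : seq nat) (p : pattern) (s : sm) (I : seq nat) : option sm :=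
  match gather 0 I s.1 [::] [::] [::] s.2 with
  | Some (before, blk, after, ms) =>
      match blk, p_lhs p with
      | (_, (kb, _)) :: _, (kl, _) :: _ =>
         let k := subn kb kl in
         if eq_diag (map snd blk) (shift k (p_lhs p)) then
           let d := map snd before ++ shift k (p_rhs p) ++ map snd after in
           Some (canon 30 (annot l0 d) (p_emit p (size before) k ++ ms))
         else None
      | _, _ => None end
  | None => None end.

Definition rewrites (l0 : seq nat) (p : pattern) (s : sm) : seq sm :=
  let g := graph (size l0) (plain s.1) in
  pmap (rewrite_at l0 p s) (find_all g (graph (size (p_in p)) (p_lhs p)) [::] [::]).

Definition is_cross (n : node) := if n is Box _ then false else true.
Definition csign (n : node) := if n is Ci _ _ then false else true.
Definition lstrand (n : node) := match n with Cr x _ | Ci x _ => x | _ => 0 end.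
Definition rstrand (n : node) := match n with Cr _ y | Ci _ y => y | _ => 0 end.

(** The equations of braided categories, sorted by their use.  [KUp] moves a crossing
    up across the node above it, [KDown] moves it down.  A node with two inputs and
    no output is a cap, one with two outputs and no input is a cup: a strand
    between its legs can leave across the one or across the other, with opposite
    signs; [KBend] and [KUnbend] are the two directions of this equation. *)
Inductive kind := KCanc | KUp | KDown | KBend | KUnbend.

Definition inv_move (m : move) : move := let: Move mv b i k := m in Move mv (~~ b) i k.
Definition flip_pat (p : pattern) : pattern :=
  Pattern (p_in p) (p_rhs p) (p_lhs p) (fun i k => rev (map inv_move (p_emit p i k))).

(** Bending is composed of the naturality of the braiding and of the insertion of a
    pair of opposite crossings. *)
Definition cap_bend (sg : bool) (n : node) (a b z : nat) : pattern :=
  Pattern [:: a; z; b] [:: (0, crossing sg a z); (1, n)] [:: (1, crossing (~~ sg) z b); (0, n)]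
   (fun i k => [:: Move (inr (Nat false sg n z)) true i.+1 k;
                   Move (inr (Canc (~~ sg) z b)) false i k.+1]).
Definition cup_bend (sg : bool) (n : node) (a b z : nat) : pattern :=
  Pattern [:: z] [:: (1, n); (0, crossing sg z a)] [:: (0, n); (1, crossing (~~ sg) b z)]
   (fun i k => [:: Move (inr (Nat true sg n z)) false i k;
                   Move (inr (Canc sg z b)) false i.+2 k.+1]).

(** The same for a cup or a cap twisted by a crossing [t] of its legs. *)
Definition twisted_cap_bend (sg : bool) (t n : node) (a b z : nat) : pattern :=
  Pattern [:: a; z; b] [:: (0, crossing sg a z); (1, t); (1, n)]
   [:: (1, crossing (~~ sg) z b); (0, t); (0, n)]
   (fun i k => [:: Move (inr (Nat false sg n z)) true i.+2 k;
                   Move (inr (Nat false sg t z)) true i.+1 k;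
                   Move (inr (Canc (~~ sg) z b)) false i k.+1]).
Definition twisted_cup_bend (sg : bool) (t n : node) (a b z : nat) : pattern :=
  Pattern [:: z] [:: (1, n); (1, t); (0, crossing sg z a)]
   [:: (0, n); (0, t); (1, crossing (~~ sg) b z)]
   (fun i k => [:: Move (inr (Nat true sg n z)) false i k;
                   Move (inr (Nat true sg t z)) false i.+1 k;
                   Move (inr (Canc sg z b)) false i.+3 k.+1]).

(** The rules that apply to a crossing [x] and a node [y] joined to it. *)
Definition node_cands (x y : gnode) : seq (kind * pattern) :=
  let: (c, ci, co) := x in let: (n, ni, no) := y in
  let sg := csign c in
  let i0 := nth 0 ci 0 in let i1 := nth 0 ci 1 in
  let o0 := nth 0 co 0 in let o1 := nth 0 co 1 in
  let c0 := memb o0 ni in let c1 := memb o1 ni in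
  let p0 := memb i0 no in let p1 := memb i1 no in
  (if c0 && c1 then
     if is_cross n && (negb (eqb sg (csign n))) && Nat.eqb o0 (nth 0 ni 0)
     then [:: (KCanc, srule_pat (Canc sg (lstrand c) (rstrand c)) true)] else [::]
   else if c0 then
     (KUp, srule_pat (Nat true sg n (lstrand c)) true) ::
     (if (Nat.eqb (size ni) 2) && (Nat.eqb (size no) 0) && Nat.eqb o0 (nth 0 ni 1)
      then [:: (KUnbend, flip_pat (cap_bend (~~ sg) n (head 0 (src n)) (rstrand c) (lstrand c)))]
      else [::])
   else if c1 then
     (KUp, srule_pat (Nat false sg n (rstrand c)) true) ::
     (if (Nat.eqb (size ni) 2) && (Nat.eqb (size no) 0) && Nat.eqb o1 (head 0 ni)
      then [:: (KBend, cap_bend sg n (lstrand c) (nth 0 (src n) 1) (rstrand c))] else [::])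
   else [::]) ++
  (if p0 && p1 then [::] else if p1 then
     (KDown, srule_pat (Nat true sg n (lstrand c)) false) ::
     (if (Nat.eqb (size ni) 0) && (Nat.eqb (size no) 2) && Nat.eqb i1 (head 0 no)
      then [:: (KBend, cup_bend sg n (rstrand c) (nth 0 (tgt n) 1) (lstrand c))] else [::])
   else if p0 then
     (KDown, srule_pat (Nat false sg n (rstrand c)) false) ::
     (if (Nat.eqb (size ni) 0) && (Nat.eqb (size no) 2) && Nat.eqb i0 (nth 0 no 1)
      then [:: (KUnbend, flip_pat (cup_bend (~~ sg) n (head 0 (tgt n)) (lstrand c) (rstrand c)))]
      else [::])
   else [::]).

(** The rules of the normal form.  Crossings move across a node from the side where it
    has a single strand, so that two nodes joined by this strand become adjacent, and
    those with a node without inputs or without outputs disappear. *)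
Definition oriented (y : gnode) (kd : kind) : bool :=
  let: (n, ni, no) := y in
  let i := size ni in let o := size no in
  match kd with
  | KCanc | KBend => true
  | KUnbend => false
  | KUp => if is_cross n then false else Nat.eqb i 1 || Nat.eqb o 0
  | KDown => if is_cross n then false else
      [|| Nat.eqb o 1 && negb (Nat.eqb i 1), Nat.eqb i 0 | Nat.ltb 1 i && Nat.ltb 1 o]
  end.

(** The rules for two crossings [x] and [y], the second of which twists the legs of a
    cup or a cap. *)
Definition twist_cands (g : seq gnode) (x y : gnode) : seq (kind * pattern) :=
  let: (c, ci, co) := x in let: (t, ti, to) := y in
  let sg := csign c in
  if negb (is_cross t) then [::] else
  let cups := [seq n.1.1 | n <- g & eq_seq n.2 ti && eq_seq n.1.2 [::]] in
  let caps := [seq n.1.1 | n <- g & eq_seq n.1.2 to && eq_seq n.2 [::]] in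
  (if Nat.eqb (nth 0 ci 1) (nth 0 to 0) && negb (memb (nth 0 ci 0) to) then
     [seq (KBend, twisted_cup_bend sg t n (rstrand c) (lstrand t) (lstrand c)) | n <- cups]
   else [::]) ++
  (if Nat.eqb (nth 0 co 1) (nth 0 ti 0) && negb (memb (nth 0 co 0) ti) then
     [seq (KBend, twisted_cap_bend sg t n (lstrand c) (rstrand t) (rstrand c)) | n <- caps]
   else [::]) ++
  (if Nat.eqb (nth 0 ci 0) (nth 0 to 1) && negb (memb (nth 0 ci 1) to) then
     [seq (KUnbend, flip_pat (twisted_cup_bend (~~ sg) t n (rstrand t) (lstrand c) (rstrand c)))
     | n <- cups]
   else [::]) ++
  (if Nat.eqb (nth 0 co 0) (nth 0 ti 1) && negb (memb (nth 0 co 1) ti) then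
     [seq (KUnbend, flip_pat (twisted_cap_bend (~~ sg) t n (lstrand t) (rstrand c) (lstrand c)))
     | n <- caps]
   else [::]).

Definition cands (sel : gnode -> kind -> bool) (g : seq gnode) : seq pattern :=
  let xs := [seq x <- g | is_cross x.1.1] in
  flatten [seq [seq c.2 | c <- node_cands x y & sel y c.1] | x <- xs, y <- g] ++
  flatten [seq [seq c.2 | c <- twist_cands g x y & sel (Cr 0 0, [::], [::]) c.1] | x <- xs, y <- g].

Fixpoint first_some (A B : Type) (f : A -> option B) (l : seq A) : option B :=
  if l is a :: l then if f a is Some b then Some b else first_some f l else None.

Definition nf_step (l0 : seq nat) (s : sm) : option sm :=
  first_some (fun p => ohead (rewrites l0 p s)) (cands oriented (graph (size l0) (plain s.1))).

Fixpoint nf_loop (fuel : nat) (l0 : seq nat) (s : sm) : sm :=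
  match fuel with 0 => s | fuel.+1 =>
    if nf_step l0 s is Some s' then nf_loop fuel l0 s' else s end.

Definition nf (l0 : seq nat) (s : sm) : sm :=
  nf_loop 200 l0 (canon 30 s.1 s.2).

(** Brings nodes back across crossings whenever this lowers the number of layers. *)
Definition contract_step (l0 : seq nat) (s : sm) : option sm :=
  first_some (fun p => if Nat.ltb (size (p_rhs p)) (size (p_lhs p))
    then ohead (rewrites l0 p s) else None)
    (cands (fun _ k => match k with KUnbend | KBend => false | _ => true end)
       (graph (size l0) (plain s.1))).

Fixpoint contract (fuel : nat) (l0 : seq nat) (s : sm) : sm :=
  match fuel with 0 => s | fuel.+1 =>
    if contract_step l0 s is Some s' then contract fuel l0 s' else s end.

Definition oriented_straight (up down : bool) (y : gnode) (kd : kind) : bool :=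
  match kd with KCanc => true | KBend => false | KUp => up && oriented y kd
  | KDown => down && oriented y kd | KUnbend => false end.

(** The normal form without bending, [up] and [down] being the allowed directions. *)
Fixpoint straight (up down : bool) (fuel : nat) (l0 : seq nat) (s : sm) : sm :=
  match fuel with 0 => s | fuel.+1 =>
    if first_some (fun p => ohead (rewrites l0 p s))
         (cands (oriented_straight up down) (graph (size l0) (plain s.1)))
      is Some s' then straight up down fuel l0 s' else s end.

(** A short form: contraction alone is blocked when a crossing was moved to the wrong
    side of a node, so crossings are driven in each direction first. *)
Definition tight (l0 : seq nat) (s : sm) : sm :=
  let f up down s := contract 60 l0 (straight up down 200 l0 s) in
  f false true (f true false (f true true s)).

Definition rewrites_any (l0 : seq nat) (p : pattern) (s : sm) : seq sm :=
  match rewrites l0 p s with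
  | [::] => match rewrites l0 p (contract 60 l0 s) with
     | [::] => rewrites l0 p (tight l0 s)
     | r => r end
  | r => r end.

Definition neighbors (sel : gnode -> kind -> bool) (l0 : seq nat) (s : sm) : seq sm :=
  flatten [seq rewrites l0 p s | p <- cands sel (graph (size l0) (plain s.1))].

Fixpoint seen (d : diag) (l : seq diag) : bool :=
  if l is e :: l then eq_diag d e || seen d l else false.

Fixpoint add_new (l : seq sm) (vis : seq diag) (acc : seq sm) : seq diag * seq sm :=
  if l is s :: l then
    let d := plain s.1 in
    if seen d vis then add_new l vis acc else add_new l (d :: vis) (s :: acc)
  else (vis, rev acc).

Fixpoint bfs (A : Type) (fuel : nat) (next : sm -> seq sm) (goal : sm -> option A)
  (queue : seq sm) (vis : seq diag) : option A :=
  match fuel with 0 => None | fuel.+1 =>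
    match queue with
    | [::] => None
    | s :: q =>
        match goal s with
        | Some a => Some a
        | None => let: (vis', new) := add_new (next s) vis [::] in
                  bfs fuel next goal (q ++ new) vis'
        end
    end
  end.

Definition explore (A : Type) (fuel : nat) (l0 : seq nat) (goal : sm -> option A) (s : sm)
    : option A :=
  bfs fuel (neighbors (fun _ _ => true) l0) goal [:: s] [:: plain s.1].

Definition bends (y : gnode) (kd : kind) : bool :=
  match kd with KUp | KDown => is_cross y.1.1 | KBend | KUnbend => true | _ => false end.

Definition explore_straight (A : Type) (fuel : nat) (l0 : seq nat) (goal : sm -> option A) (s : sm)
    : option A :=
  bfs fuel (fun s => map (straight true true 200 l0) (neighbors bends l0 s)) goal
    [:: s] [:: plain s.1].

Definition explore_bends (A : Type) (fuel : nat) (l0 : seq nat) (goal : sm -> option A) (s : sm)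
    : option A :=
  bfs fuel (fun s => map (tight l0) (neighbors bends l0 s)) goal [:: s] [:: plain s.1].

Definition inverse_moves (i k : nat) (ms : seq move) : seq move :=
  [seq (let: Move mv b i' k' := m in Move mv (~~ b) (i + i') (k + k')) | m <- ms].

(** The left side of an equation is looked for in normal form; the moves that undo the
    normalization are played before the equation is used. *)
Definition equation_pat (us : seq rule) (j : nat) : pattern :=
  let: (xs, L, R) := nth ([::], [::], [::]) us j in
  let: (s, ms) := nf xs (annot xs L, [::]) in
  Pattern xs (plain s) R (fun i k => Move (inl j) true i k :: rev (inverse_moves i k ms)).

(** [Once j] uses the equation [j] once, at an occurrence found by backtracking;
    [Many js] uses the equations [js] as long as one of them applies. *)
Inductive step := Once of nat | Many of seq nat.

Definition try_rules (l0 : seq nat) (ps : seq pattern) (s : sm) : option sm :=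
  first_some (fun p => ohead (rewrites_any l0 p s)) ps.

Fixpoint simp (fuel : nat) (l0 : seq nat) (ps : seq pattern) (s : sm) : sm :=
  match fuel with 0 => s | fuel.+1 =>
    let s := nf l0 s in
    if try_rules l0 ps s is Some s' then simp fuel l0 ps s' else s end.

Definition orelse (A : Type) (x : option A) (y : unit -> option A) : option A :=
  if x is Some _ then x else y tt.

Fixpoint solve (A : Type) (fuel : nat) (us : seq rule) (l0 : seq nat) (final : sm -> option A)
  (steps : seq step) (s : sm) : option A :=
  match steps with
  | [::] => final (nf l0 s)
  | Once j :: steps =>
      let p := equation_pat us j in
      let s := nf l0 s in
      let continue := solve fuel us l0 final steps in
      match rewrites_any l0 p s with
      | [::] =>
        let goal s := ohead (rewrites_any l0 p s) in
        obind continue (orelse (explore_straight fuel l0 goal s) (fun _ => explore fuel l0 goal s))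
      | rs => first_some continue rs
      end
  | Many js :: steps =>
      let ps := map (equation_pat us) js in
      solve fuel us l0 final steps (simp 60 l0 ps s)
  end.

Definition same_diagram (s1 s2 : sm) : option (seq move * seq move) :=
  if eq_diag (plain s1.1) (plain s2.1) then Some (rev s1.2, rev s2.2) else None.

(** The Yang-Baxter equation is used in one direction only, from the side that starts at
    the second strand, which drives different words of a braid to a common form. *)
Definition yb_only (y : gnode) (kd : kind) : bool :=
  match kd with KUp | KDown => is_cross y.1.1 | _ => false end.

Definition yb_step (l0 : seq nat) (s : sm) : option sm :=
  first_some (fun p => if p_lhs p is (1, _) :: _ then ohead (rewrites l0 p s) else None)
    (cands yb_only (graph (size l0) (plain s.1))).

Fixpoint nf_yb (fuel : nat) (l0 : seq nat) (s : sm) : sm :=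
  match fuel with 0 => s | fuel.+1 =>
    let s := nf l0 s in
    if yb_step l0 s is Some s' then nf_yb fuel l0 s' else s end.

(** The cheap tests come first; bends are explored for what they do not decide. *)
Definition isotopic (fuel : nat) (l0 : seq nat) (s1 s2 : sm) : option (seq move * seq move) :=
  let t1 := nf_yb 200 l0 s1 in let t2 := nf_yb 200 l0 s2 in
  orelse (same_diagram t1 t2) (fun _ =>
  let u1 := tight l0 t1 in let u2 := tight l0 t2 in
  orelse (same_diagram u1 u2) (fun _ =>
  explore_bends fuel l0 (fun s => same_diagram s u2) u1)).

Definition solve_eq (fuel : nat) (us : seq rule) (l0 : seq nat) (st1 st2 : seq step)
    (d1 d2 : diag) : option (seq move * seq move) :=
  solve fuel us l0 (fun s2 =>
    solve fuel us l0 (fun s1 => isotopic fuel l0 s1 s2) st1 (annot l0 d1, [::]))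
  st2 (annot l0 d2, [::]).

End Search.

(** * Reflection of arrows as diagrams *)

(** Strictness of the tensor product is built in: an object is represented by its
    word of atoms, whatever the bracketing and the units in it. *)
Inductive oexpr := OUnit | OAtom of nat | OTens of oexpr & oexpr.

Fixpoint flat (o : oexpr) : seq nat := match o with
  | OUnit => [::] | OAtom x => [:: x] | OTens o p => flat o ++ flat p end.

Inductive expr :=
  | EId of oexpr
  | EBox of nat
  | EX of bool & oexpr & oexpr
  | EComp of expr & expr
  | ETens of expr & expr.

Section Compile.
Variable ar : seq arity.

Fixpoint ty (e : expr) : option arity := match e with
  | EId o => Some (flat o, flat o)
  | EBox i => Some (nth ([::], [::]) ar i)
  | EX _ o p => Some (flat o ++ flat p, flat p ++ flat o)
  | EComp e f =>
      if (ty e, ty f) is (Some (a, b), Some (c, d)) then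
        if eq_seq d a then Some (c, b) else None else None
  | ETens e f =>
      if (ty e, ty f) is (Some (a, b), Some (c, d)) then Some (a ++ c, b ++ d) else None
  end.

Fixpoint compile (e : expr) : diag := match e with
  | EId _ => [::]
  | EBox i => [:: (0, Box i)]
  | EX b o p => crosses (crossing b) (flat o) (flat p)
  | EComp e f => compile f ++ compile e
  | ETens e f =>
      compile e ++ shift (if ty e is Some a then size a.2 else 0) (compile f)
  end.

Definition compile_eq (q : expr * expr) : option rule :=
  if (ty q.1, ty q.2) is (Some (a, b), Some (c, d)) then
    if eq_seq a c && eq_seq b d then Some (a, compile q.1, compile q.2) else None
  else None.

Definition compile_eqs (qs : seq (expr * expr)) : seq rule :=
  [seq odflt ([::], [::], [::]) (compile_eq q) | q <- qs].

Definition check (qs : seq (expr * expr)) (q : expr * expr) (ms : seq move * seq move) : bool :=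
  if compile_eq q is Some (l, d1, d2) then
    let us := compile_eqs qs in
    if (play ar us l ms.1 d1, play ar us l ms.2 d2) is (Some e1, Some e2)
    then eq_diag e1 e2 else false
  else false.

Definition search (fuel : nat) (qs : seq (expr * expr)) (st1 st2 : seq step)
    (q : expr * expr) :=
  if compile_eq q is Some (l, d1, d2) then solve_eq ar fuel (compile_eqs qs) l st1 st2 d1 d2
  else None.
End Compile.

Section Sound.
Variable C : braided_category.
Variables (obl : seq (Ob C)) (arrs : seq (Mor C)) (ars : seq (oexpr * oexpr)).

Definition atom (x : nat) : Ob C := nth unitO obl x.

Fixpoint oev (o : oexpr) : Ob C := match o with
  | OUnit => unitO | OAtom x => atom x | OTens o p => oev o ⊠ oev p end.

Lemma oevE o : oev o = obs atom (flat o).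
Proof.
by elim: o => [|x|o IHo p IHp] //=; rewrite ?tensO_unit_r // obs_cat IHo IHp.
Qed.

Definition box (i : nat) : Mor C := nth (idm unitO) arrs i.

Fixpoint ev (e : expr) : Mor C := match e with
  | EId o => idm (oev o)
  | EBox i => box i
  | EX true o p => br (oev o) (oev p)
  | EX false o p => inv (br (oev p) (oev o))
  | EComp e f => ev e ∘ ev f
  | ETens e f => ev e ⊗ ev f end.

Definition arities : seq arity := [seq (flat a.1, flat a.2) | a <- ars].

Fixpoint all_homs (fs : seq (Mor C)) (l : seq (oexpr * oexpr)) : Prop := match fs, l with
  | [::], [::] => True
  | f :: fs, a :: l => (f ∈ oev a.1 ⟶ oev a.2) /\ all_homs fs l
  | _, _ => False end.

Fixpoint all_eqs (qs : seq (expr * expr)) : Prop :=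
  if qs is q :: qs then ev q.1 = ev q.2 /\ all_eqs qs else True.

Hypothesis homs : all_homs arrs ars.

Lemma box_hom i : box i ∈ obs atom (nth ([::], [::]) arities i).1
                       ⟶ obs atom (nth ([::], [::]) arities i).2.
Proof.
rewrite /box /arities; elim: arrs ars homs i => [|f fs IH] [|[a b] l] //=.
  by move=> _ i; rewrite !nth_nil; exact: hom_idm.
by move=> [h hs] [|i] /=; [rewrite -!oevE | exact: IH].
Qed.

Local Notation den := (den atom arities box).
Local Notation run := (run arities).

(** Composites are arbitrary arrows when domains and codomains do not match; the test
    [ty] ensures that only composable arrows are translated. *)
Lemma compileP e a : ty arities e = Some a ->
  run a.1 (compile arities e) = Some a.2 /\ den a.1 (compile arities e) = ev e.
Proof.
have bh := box_hom.
elim: e a => [o|i|b o p|e IHe f IHf|e IHe f IHf] a /=.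
- by move=> [<-]; rewrite /= oevE.
- move=> [<-].
  have h := exec_cat arities [::] [::] (Box i).
  have h' := den_layer_cat atom arities box [::] [::] (Box i).
  rewrite /= !cats0 in h h' *; rewrite h h' tens_unit_l tens_unit_r; split=> //.
  exact: comp_idl (bh i).
- move=> [<-] /=; have [-> ->] := den_crosses bh b (flat o) (flat p); split=> //.
  by rewrite /xing -!oevE; case: b.
- case: (ty _ e) IHe => [[a1 b1]|//] IHe; case: (ty _ f) IHf => [[a2 b2]|//] IHf.
  case: ifP => // /eq_seqP ?; subst => -[<-] /=.
  have [e1 e2] := IHe _ erefl; have [f1 f2] := IHf _ erefl; rewrite /= in e1 e2 f1 f2.
  by rewrite run_cat f1 e1 (den_cat bh f1 e1) e2 f2.
- case: (ty _ e) IHe => [[a1 b1]|//] IHe; case: (ty _ f) IHf => [[a2 b2]|//] IHf.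
  move=> [<-] /=.
  have [e1 e2] := IHe _ erefl; have [f1 f2] := IHf _ erefl; rewrite /= in e1 e2 f1 f2.
  have h1 := run_shift [::] a2 e1; have h2 := run_shift b1 [::] f1.
  have d1 := den_shift bh [::] a2 e1; have d2 := den_shift bh b1 [::] f1.
  rewrite /= !cats0 !shift0 in h1 h2 d1 d2.
  rewrite run_cat h1 h2 (den_cat bh h1 h2) d1 d2 e2 f2; split=> //.
  rewrite !tens_unit_l !tens_unit_r.
  have he := den_hom bh e1; have hf := den_hom bh f1; rewrite e2 f2 in he hf.
  rewrite (tens_compE he (hom_idm _) (hom_idm _) hf).
  by rewrite (comp_idl he) (comp_idr hf).
Qed.

Lemma hom_sound e o p :
  (if ty arities e is Some a then eq_seq a.1 (flat o) && eq_seq a.2 (flat p) else false) ->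
  ev e ∈ oev o ⟶ oev p.
Proof.
case E: (ty _ e) => [a|//] /andP[/eq_seqP e1 /eq_seqP e2].
by have [h <-] := compileP E; have := den_hom box_hom h; rewrite !oevE e1 e2.
Qed.

Lemma compile_eqP q l d1 d2 : compile_eq arities q = Some (l, d1, d2) ->
  exists m, [/\ run l d1 = Some m, run l d2 = Some m, den l d1 = ev q.1 & den l d2 = ev q.2].
Proof.
rewrite /compile_eq; case E1: (ty _ q.1) => [[a b]|//]; case E2: (ty _ q.2) => [[c d]|//].
case: ifP => // /andP[/eq_seqP ? /eq_seqP ?]; subst => -[<- <- <-]; exists d.
by have [] := compileP E1; have [] := compileP E2.
Qed.

Lemma compile_eqs_valid qs : all_eqs qs -> all_valid atom arities box (compile_eqs arities qs).
Proof.
elim: qs => //= q qs IH [hq hqs]; split; last exact: IH.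
case E: (compile_eq _ q) => [[[l d1] d2]|]; last by exists [::].
by have [m [h1 h2 h3 h4]] := compile_eqP E; exists m; split=> //; rewrite h3 h4.
Qed.

(** The equation holds if the moves found for its two sides, which may use the equations
    [qs], lead to the same diagram. *)
Lemma diagram_sound qs q ms : all_eqs qs -> check arities qs q ms -> ev q.1 = ev q.2.
Proof.
move=> /compile_eqs_valid hqs; rewrite /check.
case E: (compile_eq _ q) => [[[l d1] d2]|//].
have [m [h1 h2 <- <-]] := compile_eqP E.
case P1: (play _ _ _ ms.1 _) => [e1|//]; case P2: (play _ _ _ ms.2 _) => [e2|//].
move=> /eq_diagP ?; subst.
have [_ ->] := play_sound box_hom hqs P1 h1.
by have [_ ->] := play_sound box_hom hqs P2 h2.
Qed.

End Sound.

(** * The tactic for diagrammatic equations *)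

(** Marks a group of equations to be used as often as possible; see [diagram]. *)
Definition exhaust (T : Type) (x : T) := x.

(* The goals are stated with the records of the theory; their projections are computed
   before objects and arrows are recognized. *)
Ltac dg_norm t :=
  eval cbn [yd_ob act coact yd_mod yd_tens yd_unit yd_alg yd_act yd_coact
            carrier mul one comul counit biproduct Omega pd_A pd_B pd_pi pd_iota pd_pairing] in t.

Create HintDb hom discriminated.

(* The type of an atomic arrow comes from the lemmas of the database [hom]. *)
Ltac dg_hom m := constr:(ltac:(eauto 6 with nocore hom) : m ∈ _ ⟶ _).

Ltac dg_add x l :=
  lazymatch l with
  | [::] => constr:(([:: x], 0))
  | ?y :: ?t => match constr:(y) with
      | x => constr:((l, 0))
      | _ => match dg_add x t with (?t', ?n) => constr:((y :: t', S n)) end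
      end
  end.

(* In the tactics below, [obl] lists the atomic objects seen so far, and the nested tuple
   [ents] the atomic arrows, each with its source, target and typing proof. *)
Ltac dg_ob obl X :=
  lazymatch X with
  | unitO => constr:((obl, OUnit))
  | tensO ?X ?Y => match dg_ob obl X with (?obl, ?o) =>
      match dg_ob obl Y with (?obl, ?p) => constr:((obl, OTens o p)) end end
  | _ => match dg_add X obl with (?obl, ?n) => constr:((obl, OAtom n)) end
  end.

Ltac dg_box obl ents m :=
  lazymatch ents with
  | tt => let pf := dg_hom m in
      let T := type of pf in
      lazymatch T with (dom m = ?X) /\ (cod m = ?Y) =>
        let X := dg_norm X in let Y := dg_norm Y in
        match dg_ob obl X with (?obl, ?o) => match dg_ob obl Y with (?obl, ?p) =>
          constr:((obl, (((m, o, p), pf), tt), 0)) end end end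
  | (((?f, ?o, ?p), ?pf), ?r) => match constr:(f) with
      | m => constr:((obl, ents, 0))
      | _ => match dg_box obl r m with (?obl, ?r', ?n) =>
           constr:((obl, (((f, o, p), pf), r'), S n)) end end
  end.

Ltac dg_mor obl ents m :=
  lazymatch m with
  | idm ?X => match dg_ob obl X with (?obl, ?o) => constr:((obl, ents, EId o)) end
  | comp ?g ?f => match dg_mor obl ents g with (?obl, ?ents, ?e) =>
      match dg_mor obl ents f with (?obl, ?ents, ?e') => constr:((obl, ents, EComp e e')) end end
  | tens ?g ?f => match dg_mor obl ents g with (?obl, ?ents, ?e) =>
      match dg_mor obl ents f with (?obl, ?ents, ?e') => constr:((obl, ents, ETens e e')) end end
  | inv (br ?X ?Y) => match dg_ob obl X with (?obl, ?o) => match dg_ob obl Y with (?obl, ?p) =>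
      constr:((obl, ents, EX false p o)) end end
  | br ?X ?Y => match dg_ob obl X with (?obl, ?o) => match dg_ob obl Y with (?obl, ?p) =>
      constr:((obl, ents, EX true o p)) end end
  | _ => match dg_box obl ents m with (?obl, ?ents, ?n) => constr:((obl, ents, EBox n)) end
  end.

Ltac dg_eq obl ents T :=
  let T := dg_norm T in
  lazymatch T with ?a = ?b => match dg_mor obl ents a with (?obl, ?ents, ?e) =>
     match dg_mor obl ents b with (?obl, ?ents, ?e') => constr:((obl, ents, (e, e'))) end end end.

(* [qs] is the nested tuple of the equations used so far, with their proofs. *)
Ltac dg_rule obl ents qs H :=
  lazymatch qs with
  | tt => let T := type of H in
      match dg_eq obl ents T with (?obl, ?ents, ?q) => constr:((obl, ents, ((q, H), tt), 0)) end
  | ((?q, ?H'), ?r) => match constr:(H') with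
     | H => constr:((obl, ents, qs, 0))
     | _ => match dg_rule obl ents r H with (?obl, ?ents, ?r', ?n) =>
         constr:((obl, ents, ((q, H'), r'), S n)) end end
  end.

Ltac dg_rules obl ents qs Hs :=
  lazymatch Hs with
  | pair ?Hs ?Gs => match dg_rules obl ents qs Hs with (?obl, ?ents, ?qs, ?ns) =>
      match dg_rules obl ents qs Gs with (?obl, ?ents, ?qs, ?ms) =>
        constr:((obl, ents, qs, ns ++ ms)) end end
  | ?H => match dg_rule obl ents qs H with (?obl, ?ents, ?qs, ?n) =>
      constr:((obl, ents, qs, [:: n])) end
  end.

Ltac dg_step obl ents qs H :=
  lazymatch H with
  | exhaust ?Hs => match dg_rules obl ents qs Hs with (?obl, ?ents, ?qs, ?ns) =>
      constr:((obl, ents, qs, Many ns)) end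
  | _ => match dg_rule obl ents qs H with (?obl, ?ents, ?qs, ?n) =>
      constr:((obl, ents, qs, Once n)) end
  end.

Ltac dg_steps obl ents qs Hs :=
  lazymatch Hs with
  | tt => constr:((obl, ents, qs, @nil step))
  | pair ?Hs ?Gs => match dg_steps obl ents qs Hs with (?obl, ?ents, ?qs, ?l) =>
      match dg_steps obl ents qs Gs with (?obl, ?ents, ?qs, ?l') =>
        constr:((obl, ents, qs, l ++ l')) end end
  | ?H => match dg_step obl ents qs H with (?obl, ?ents, ?qs, ?s) =>
      constr:((obl, ents, qs, [:: s])) end
  end.

Ltac dg_arrs C ents := lazymatch ents with
  | tt => constr:(@nil (Mor C))
  | (((?f, _, _), _), ?r) => let l := dg_arrs C r in constr:(f :: l) end.
Ltac dg_ars ents := lazymatch ents with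
  | tt => constr:(@nil (oexpr * oexpr))
  | (((_, ?o, ?p), _), ?r) => let l := dg_ars r in constr:((o, p) :: l) end.
Ltac dg_homs ents := lazymatch ents with
  | tt => constr:(Logic.I)
  | ((_, ?pf), ?r) => let l := dg_homs r in constr:(conj pf l) end.
Ltac dg_qs qs := lazymatch qs with
  | tt => constr:(@nil (expr * expr))
  | ((?q, _), ?r) => let l := dg_qs r in constr:(q :: l) end.
Ltac dg_hyps qs := lazymatch qs with
  | tt => constr:(Logic.I)
  | ((_, ?H), ?r) => let l := dg_hyps r in constr:(conj H l) end.

Ltac dg_with fuel st1 st2 k :=
  lazymatch goal with |- @eq (Mor ?C) _ _ =>
  let C := lazymatch C with smc ?C => C end in
  let T := lazymatch goal with |- ?T => T end in
  match dg_eq (@nil (Ob C)) tt T with (?obl, ?ents, ?q) =>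
  match dg_steps obl ents tt st1 with (?obl, ?ents, ?qs, ?l1) =>
  match dg_steps obl ents qs st2 with (?obl, ?ents, ?qs, ?l2) =>
  let arrs := dg_arrs C ents in let ars := dg_ars ents in let hs := dg_homs ents in
  let hyps := dg_hyps qs in let qs := dg_qs qs in
  let l1 := eval cbv in l1 in let l2 := eval cbv in l2 in
  k C obl arrs ars hs hyps qs q l1 l2 fuel
  end end end end.

Ltac dg_solve C obl arrs ars hs hyps qs q l1 l2 fuel :=
  let cert := eval vm_compute in (search (arities ars) fuel qs l1 l2 q) in
  lazymatch cert with
  | Some ?ms =>
    exact (@diagram_sound C obl arrs ars hs qs q ms hyps
             (@erefl bool true <: check (arities ars) qs q ms = true))
  | None => fail "diagram: no proof found"
  end.

(** The goals are of the form [m ∈ X ⟶ Y]. *)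
Ltac diagram_hom :=
  lazymatch goal with |- dom ?m = ?X /\ cod ?m = ?Y =>
  let C := lazymatch type of m with Mor (smc ?C) => C end in
  let m := dg_norm m in let X := dg_norm X in let Y := dg_norm Y in
  match dg_mor (@nil (Ob C)) tt m with (?obl, ?ents, ?e) =>
  match dg_ob obl X with (?obl, ?o) => match dg_ob obl Y with (?obl, ?p) =>
  let arrs := dg_arrs C ents in let ars := dg_ars ents in let hs := dg_homs ents in
  exact (@hom_sound C obl arrs ars hs e o p (@erefl bool true))
  end end end end.

(** [diagram (h1, .., hn) | (g1, .., gm)] proves an equation of arrows of a braided
    category: the equations [h1], .., [hn] are used from left to right, in this order
    and each at one place of the left side, then [g1], .., [gm] on the right side,
    up to isotopy of diagrams, and the two sides must become isotopic. *)
Tactic Notation "diagram" := dg_with 300 tt tt dg_solve.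
Tactic Notation "diagram" uconstr(h) := let h := constr:(h) in dg_with 300 h tt dg_solve.
Tactic Notation "diagram" uconstr(h) "|" uconstr(h') :=
  let h := constr:(h) in let h' := constr:(h') in dg_with 300 h h' dg_solve.
(* [n] bounds the numbers of isotopic diagrams that are tried. *)
Tactic Notation "diagram_with" constr(n) uconstr(h) "|" uconstr(h') :=
  let h := constr:(h) in let h' := constr:(h') in dg_with n h h' dg_solve.
Tactic Notation "diagram_rhs" uconstr(h) := let h := constr:(h) in dg_with 300 tt h dg_solve.

#[export] Hint Resolve mul_hom one_hom comul_hom counit_hom act_hom coact_hom : hom.

(** * Antipodes *)

(** Hopf algebras with a chosen antipode [S] and its inverse [T], so that diagrams can
    contain them as boxes. *)
Record hopf_with (C : braided_category) (A : bialg C) (S T : Mor C) : Prop := HopfWith {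
  hopf_bialgebra :> is_bialgebra (br A A) A;
  antipode_hom : S ∈ A ⟶ A;
  inv_antipode_hom : T ∈ A ⟶ A;
  antipode_l : mul A ∘ (S ⊗ idm A) ∘ comul A = one A ∘ counit A;
  antipode_r : mul A ∘ (idm A ⊗ S) ∘ comul A = one A ∘ counit A;
  antipodeK : T ∘ S = idm A;
  inv_antipodeK : S ∘ T = idm A
}.
#[export] Hint Resolve hopf_bialgebra antipode_hom inv_antipode_hom : hom.

Notation unit_laws h := (mul_one_l h, mul_one_r h, counit_comul_l h, counit_comul_r h).
Notation point_laws h := (counit_mul h, comul_one h, counit_one h).

Section Antipode.
Variables (C : braided_category) (A : bialg C) (S T : Mor C).
Hypothesis hA : hopf_with A S T.

Lemma antipode_one : S ∘ one A = one A.
Proof.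
transitivity (mul A ∘ (S ⊗ idm A) ∘ comul A ∘ one A).
  diagram_rhs (comul_one hA, exhaust (unit_laws hA)).
diagram (antipode_l hA, exhaust (counit_one hA)).
Qed.

Lemma counit_antipode : counit A ∘ S = counit A.
Proof.
transitivity (counit A ∘ mul A ∘ (S ⊗ idm A) ∘ comul A).
  diagram_rhs (counit_mul hA, exhaust (unit_laws hA)).
diagram (antipode_l hA, exhaust (counit_one hA)).
Qed.

(** In the convolution algebra of arrows from [A ⊗ A] to [A], both sides of
    [antipode_mul] are inverse to the multiplication, on the left and on the right;
    [M] is the convolution product of the three.  [N] plays the same role for arrows
    from [A] to [A ⊗ A]. *)
Let M := mul A ∘ ((S ∘ mul A) ⊗ (mul A ∘ (mul A ⊗ (mul A ∘ br A A ∘ (S ⊗ S))))) ∘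
  (idm (A ⊠ A) ⊗ idm A ⊗ br A A ⊗ idm A) ∘ (idm A ⊗ br A A ⊗ idm A ⊗ idm A ⊗ idm A) ∘
  (idm A ⊗ idm A ⊗ br A A ⊗ idm A ⊗ idm A) ∘
  (((idm A ⊗ comul A) ∘ comul A) ⊗ ((idm A ⊗ comul A) ∘ comul A)).

Lemma antipode_mul : S ∘ mul A = mul A ∘ br A A ∘ (S ⊗ S).
Proof.
transitivity M; rewrite /M.
  diagram_rhs (mul_assoc hA, esym (mul_assoc hA), antipode_r hA,
    exhaust (antipode_r hA, unit_laws hA)).
diagram (esym (mul_assoc hA), esym (comul_coassoc hA), esym (comul_coassoc hA),
  esym (comul_mul hA), antipode_l hA, exhaust (unit_laws hA, point_laws hA)).
Qed.

Let N := ((mul A ∘ (idm A ⊗ mul A)) ⊗ (mul A ∘ (idm A ⊗ mul A))) ∘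
  (idm A ⊗ idm A ⊗ br A A ⊗ idm A ⊗ idm A) ∘ (idm A ⊗ br A A ⊗ idm A ⊗ idm A ⊗ idm A) ∘
  (idm (A ⊠ A) ⊗ idm A ⊗ br A A ⊗ idm A) ∘
  ((comul A ∘ S) ⊗ ((comul A ⊗ ((S ⊗ S) ∘ br A A ∘ comul A)) ∘ comul A)) ∘ comul A.

Lemma antipode_comul : comul A ∘ S = (S ⊗ S) ∘ br A A ∘ comul A.
Proof.
transitivity N; rewrite /N.
  diagram_rhs (comul_coassoc hA, esym (comul_coassoc hA), antipode_r hA,
    exhaust (antipode_r hA, unit_laws hA)).
diagram (esym (comul_coassoc hA), esym (mul_assoc hA), esym (mul_assoc hA),
  esym (comul_mul hA), antipode_l hA, exhaust (unit_laws hA, point_laws hA)).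
Qed.

Lemma inv_antipode_one : T ∘ one A = one A.
Proof.
transitivity (T ∘ S ∘ one A); first by diagram_rhs (antipode_one).
diagram (antipodeK hA).
Qed.

Lemma counit_inv_antipode : counit A ∘ T = counit A.
Proof.
transitivity (counit A ∘ S ∘ T); first by diagram_rhs (counit_antipode).
diagram (inv_antipodeK hA).
Qed.

Lemma inv_antipode_mul : T ∘ mul A = mul A ∘ inv (br A A) ∘ (T ⊗ T).
Proof.
have e : mul A ∘ (S ⊗ S) = S ∘ mul A ∘ inv (br A A) by diagram_rhs antipode_mul.
transitivity (T ∘ mul A ∘ (S ⊗ S) ∘ (T ⊗ T)).
  diagram_rhs (exhaust (inv_antipodeK hA)).
diagram (e, antipodeK hA).
Qed.

Lemma inv_antipode_comul : comul A ∘ T = (T ⊗ T) ∘ inv (br A A) ∘ comul A.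
Proof.
have e : (S ⊗ S) ∘ comul A = inv (br A A) ∘ comul A ∘ S by diagram_rhs antipode_comul.
transitivity ((T ⊗ T) ∘ (S ⊗ S) ∘ comul A ∘ T).
  diagram_rhs (exhaust (antipodeK hA)).
diagram (e, inv_antipodeK hA).
Qed.

(** The inverse antipode satisfies the axioms of an antipode for the multiplication
    twisted by the inverse braiding, since it is anti-multiplicative in that sense. *)
Lemma inv_antipode_l : mul A ∘ inv (br A A) ∘ (T ⊗ idm A) ∘ comul A = one A ∘ counit A.
Proof.
transitivity (T ∘ mul A ∘ (idm A ⊗ S) ∘ comul A).
  diagram_rhs (inv_antipode_mul, exhaust (antipodeK hA)).
diagram (antipode_r hA, inv_antipode_one).
Qed.

Lemma inv_antipode_r : mul A ∘ inv (br A A) ∘ (idm A ⊗ T) ∘ comul A = one A ∘ counit A.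
Proof.
transitivity (T ∘ mul A ∘ (S ⊗ idm A) ∘ comul A).
  diagram_rhs (inv_antipode_mul, exhaust (antipodeK hA)).
diagram (antipode_l hA, inv_antipode_one).
Qed.

End Antipode.

(** * Hopf pairings *)

Record pairing_with (C : braided_category) (A B : bialg C) (w w' : Mor C) : Prop := PairingWith {
  pair_hom : w ∈ A ⊠ B ⟶ unitO;
  copair_hom : w' ∈ unitO ⟶ B ⊠ A;
  pair_mul_l : w ∘ (mul A ⊗ idm B) = w ∘ (idm A ⊗ w ⊗ idm B) ∘ (idm (A ⊠ A) ⊗ comul B);
  pair_one_l : w ∘ (one A ⊗ idm B) = counit B;
  pair_mul_r : w ∘ (idm A ⊗ mul B) = w ∘ (idm A ⊗ w ⊗ idm B) ∘ (comul A ⊗ idm (B ⊠ B));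
  pair_one_r : w ∘ (idm A ⊗ one B) = counit A;
  snake_l : (w ⊗ idm A) ∘ (idm A ⊗ w') = idm A;
  snake_r : (idm B ⊗ w) ∘ (w' ⊗ idm B) = idm B
}.
#[export] Hint Resolve pair_hom copair_hom : hom.
Notation snakes h := (snake_l h, snake_r h).

Section Pairing.
Variables (C : braided_category) (A B : bialg C) (SA TA SB TB w w' : Mor C).
Hypothesis hA : hopf_with A SA TA.
Hypothesis hB : hopf_with B SB TB.
Hypothesis hw : pairing_with A B w w'.

(** Both sides are inverse to [w] for the convolution of arrows from [A ⊗ B] to [1]; the
    middle term is the convolution product of the three. *)
Lemma pairing_antipode : w ∘ (SA ⊗ idm B) = w ∘ (idm A ⊗ SB).
Proof.
transitivity (w ∘ (SA ⊗ w ⊗ idm B) ∘ (idm (A ⊠ A) ⊗ (w ∘ (idm A ⊗ SB)) ⊗ idm (B ⊠ B)) ∘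
  (((idm A ⊗ comul A) ∘ comul A) ⊗ ((idm B ⊗ comul B) ∘ comul B))).
  diagram_rhs (esym (comul_coassoc hB), esym (pair_mul_r hw), antipode_l hB, pair_one_r hw,
    exhaust (unit_laws hA, unit_laws hB)).
diagram (esym (comul_coassoc hA), esym (pair_mul_l hw), antipode_l hA, pair_one_l hw,
  exhaust (unit_laws hA, unit_laws hB)).
Qed.

(* Laws of [w'] follow from laws of [w] by bending strands: the middle terms contain
   zigzags of [w] and [w'], which are straightened in two ways. *)

Lemma copairing_antipode : (SB ⊗ idm A) ∘ w' = (idm B ⊗ SA) ∘ w'.
Proof.
transitivity ((idm B ⊗ (w ∘ (idm A ⊗ SB)) ⊗ idm A) ∘ (w' ⊗ w')).
  diagram_rhs (snake_r hw).
diagram (esym pairing_antipode, snake_l hw).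
Qed.

Lemma copair_comul_l :
  (comul B ⊗ idm A) ∘ w' = (idm (B ⊠ B) ⊗ mul A) ∘ (idm B ⊗ w' ⊗ idm A) ∘ w'.
Proof.
transitivity ((idm (B ⊠ B) ⊗ (w ∘ (idm A ⊗ w ⊗ idm B)) ⊗ idm A) ∘
  (idm B ⊗ w' ⊗ idm (A ⊠ B ⊠ B ⊠ A)) ∘ (w' ⊗ idm (B ⊠ B ⊠ A)) ∘ (comul B ⊗ idm A) ∘ w').
  diagram_rhs (exhaust (snakes hw)).
diagram (esym (pair_mul_l hw), snake_l hw).
Qed.

Lemma copair_comul_r :
  (idm B ⊗ comul A) ∘ w' = (mul B ⊗ idm (A ⊠ A)) ∘ (idm B ⊗ w' ⊗ idm A) ∘ w'.
Proof.
transitivity ((idm B ⊗ (w ∘ (idm A ⊗ w ⊗ idm B)) ⊗ idm (A ⊠ A)) ∘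
  (idm (B ⊠ A ⊠ A ⊠ B) ⊗ w' ⊗ idm A) ∘ (idm (B ⊠ A ⊠ A) ⊗ w') ∘ (idm B ⊗ comul A) ∘ w').
  diagram_rhs (exhaust (snakes hw)).
diagram (esym (pair_mul_r hw), snake_r hw).
Qed.

Lemma copair_counit_l : (counit B ⊗ idm A) ∘ w' = one A.
Proof.
transitivity ((w ⊗ idm A) ∘ (one A ⊗ w')); first by diagram_rhs (pair_one_l hw).
diagram (snake_l hw).
Qed.

Lemma copair_counit_r : (idm B ⊗ counit A) ∘ w' = one B.
Proof.
transitivity ((idm B ⊗ w) ∘ (w' ⊗ one B)); first by diagram_rhs (pair_one_r hw).
diagram (snake_r hw).
Qed.

Lemma pairing_inv_antipode : w ∘ (TA ⊗ idm B) = w ∘ (idm A ⊗ TB).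
Proof.
transitivity (w ∘ (SA ⊗ idm B) ∘ (TA ⊗ TB)).
  diagram_rhs (pairing_antipode, inv_antipodeK hB).
diagram (inv_antipodeK hA).
Qed.

Definition minus_pairing := w ∘ inv (br A B) ∘ (TB ⊗ TA).
Definition minus_copairing := (SA ⊗ SB) ∘ br B A ∘ w'.

(** With the inverse braiding alone the axioms would hold up to braidings only; these
    cancel against the braidings that appear when the inverse antipodes pass products
    and coproducts. *)
Lemma minus_pairing_with : pairing_with B A minus_pairing minus_copairing.
Proof.
split; rewrite /minus_pairing /minus_copairing; try diagram_hom.
- diagram (inv_antipode_mul hB, pair_mul_r hw, inv_antipode_comul hA).
- diagram (inv_antipode_one hB, pair_one_r hw, counit_inv_antipode hA).
- diagram (inv_antipode_mul hA, pair_mul_l hw, inv_antipode_comul hB).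
- diagram (inv_antipode_one hA, pair_one_l hw, counit_inv_antipode hB).
- diagram (antipodeK hA, snake_r hw, inv_antipodeK hB).
- diagram (antipodeK hB, snake_l hw, inv_antipodeK hA).
Qed.
End Pairing.

(** * The functor without antipodes *)

(** The squares of antipodes in the definition of the functor belong to the pairing
    [w].  They disappear when the functor is expressed by the pairing [k] between [B]
    and [A] with copairing [k']: the coaction is paired with [B] directly, and the
    coaction of [B] comes from the right action of [A] through the inverse
    braiding. *)
Section OmegaForms.
Variables (C : braided_category) (A B : bialg C) (SA TA SB TB w w' : Mor C).
Hypothesis hA : hopf_with A SA TA.
Hypothesis hB : hopf_with B SB TB.
Hypothesis hw : pairing_with A B w w'.
Variable X : yd C.
Hypothesis hX : is_yd A X.

Lemma Omega_act_minus :
  (idm X ⊗ w) ∘ (inv (br X A) ⊗ (TB ∘ TB)) ∘ (coact X ⊗ idm B) ∘ inv (br X B) =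
  (minus_pairing A B TA TB w ⊗ idm X) ∘ (idm B ⊗ coact X).
Proof. rewrite /minus_pairing. diagram_rhs (pairing_inv_antipode hA hB hw). Qed.

Lemma coact_bend (u : Mor C) : u ∈ unitO ⟶ B ⊠ A ->
  br X B ∘ br B X ∘ (idm B ⊗ act X) ∘ (u ⊗ idm X) =
  br X B ∘ ((act X ∘ inv (br A X)) ⊗ idm B) ∘ (idm X ⊗ (br B A ∘ u)).
Proof. move=> hu; diagram. Qed.

Lemma Omega_coact_minus :
  br X B ∘ br B X ∘ ((SB ∘ SB) ⊗ act X) ∘ (w' ⊗ idm X) =
  br X B ∘ ((act X ∘ inv (br A X)) ⊗ idm B) ∘ (idm X ⊗ minus_copairing A B SA SB w').
Proof.
have hu : ((SB ∘ SB) ⊗ idm A) ∘ w' ∈ unitO ⟶ B ⊠ A by diagram_hom.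
have -> : minus_copairing A B SA SB w' = br B A ∘ (((SB ∘ SB) ⊗ idm A) ∘ w').
  rewrite /minus_copairing; diagram (esym (copairing_antipode hA hB hw)).
rewrite -(coact_bend hu); diagram.
Qed.
End OmegaForms.

Section RightAction.
Variables (C : braided_category) (A : bialg C) (SA TA : Mor C).
Hypothesis hA : hopf_with A SA TA.
Variable X : yd C.
Hypothesis hX : is_yd A X.

(** A right action for the opposite multiplication; with it the condition on
    Yetter-Drinfel'd modules takes the form [ract_yd]. *)
Definition ract : Mor C := act X ∘ inv (br A X).

Lemma ract_hom : ract ∈ X ⊠ A ⟶ X.
Proof. rewrite /ract; diagram_hom. Qed.

Lemma ract_mul : ract ∘ (ract ⊗ idm A) = ract ∘ (idm X ⊗ (mul A ∘ inv (br A A))).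
Proof. rewrite /ract. diagram_rhs (act_mul hX). Qed.

Lemma ract_one : ract ∘ (idm X ⊗ one A) = idm X.
Proof. rewrite /ract. diagram (act_one hX). Qed.

Lemma ract_yd :
  ((mul A ∘ inv (br A A)) ⊗ ract) ∘ (idm A ⊗ inv (br A X) ⊗ idm A) ∘ (coact X ⊗ comul A) =
  (mul A ⊗ idm X) ∘ (idm A ⊗ br X A) ∘ (coact X ⊗ idm A) ∘ (ract ⊗ idm A) ∘ (idm X ⊗ comul A).
Proof.
rewrite /ract; diagram (congr1 (fun f => f ∘ inv (br A X)) (yd_condition hX)).
Qed.

End RightAction.
#[export] Hint Resolve ract_hom : hom.

Section Transport.
Variables (C : braided_category) (A B : bialg C) (SA TA SB TB k k' : Mor C).
Hypothesis hA : hopf_with A SA TA.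
Hypothesis hB : hopf_with B SB TB.
Hypothesis hk : pairing_with B A k k'.

Definition dual_act (X : yd C) : Mor C := (k ⊗ idm X) ∘ (idm B ⊗ coact X).
Definition dual_rcoact (X : yd C) : Mor C := (ract A X ⊗ idm B) ∘ (idm X ⊗ k').
Definition dual_yd (X : yd C) : yd C := YD X (dual_act X) (br X B ∘ dual_rcoact X).

Section OneModule.
Variable X : yd C.
Hypothesis hX : is_yd A X.

Lemma dual_act_hom : dual_act X ∈ B ⊠ X ⟶ X.
Proof. rewrite /dual_act; diagram_hom. Qed.
Lemma dual_rcoact_hom : dual_rcoact X ∈ X ⟶ X ⊠ B.
Proof. rewrite /dual_rcoact; diagram_hom. Qed.
Hint Resolve dual_act_hom dual_rcoact_hom : hom.

Lemma dual_rcoact_comul : (idm X ⊗ comul B) ∘ dual_rcoact X =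
  (idm X ⊗ br B B) ∘ (dual_rcoact X ⊗ idm B) ∘ dual_rcoact X.
Proof.
rewrite /dual_rcoact. diagram (copair_comul_r hB hA hk) | (ract_mul hA hX).
Qed.

Lemma dual_rcoact_counit : (idm X ⊗ counit B) ∘ dual_rcoact X = idm X.
Proof. rewrite /dual_rcoact. diagram (copair_counit_r hB hA hk, ract_one hA hX). Qed.

(** Pairing the two outer legs of the condition for [A] with elements of [B] gives the
    condition for [B]: products of one side become coproducts of the other. *)
Lemma dual_rcoact_yd :
  (mul B ⊗ dual_act X) ∘ (idm B ⊗ br B B ⊗ idm X) ∘ (comul B ⊗ (br X B ∘ dual_rcoact X)) =
    (mul B ⊗ idm X) ∘ (idm B ⊗ br X B) ∘ ((br X B ∘ dual_rcoact X) ⊗ idm B)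
      ∘ (dual_act X ⊗ idm B) ∘ (idm B ⊗ br B X) ∘ (comul B ⊗ idm X).
Proof.
transitivity (br X B ∘ (k ⊗ idm (X ⊠ B)) ∘ (idm B ⊗ ((mul A ⊗ idm X) ∘ (idm A ⊗ br X A) ∘
  (coact X ⊗ idm A) ∘ (ract A X ⊗ idm A) ∘ (idm X ⊗ comul A)) ⊗ idm B) ∘ (idm (B ⊠ X) ⊗ k')).
  rewrite /dual_act /dual_rcoact.
  diagram_rhs (pair_mul_r hk, copair_comul_l hB hA hk, snake_l hk).
rewrite -(ract_yd hA hX) /dual_act /dual_rcoact.
diagram (pair_mul_r hk, copair_comul_l hB hA hk, snake_l hk).
Qed.

Lemma dual_is_yd : is_yd B (dual_yd X).
Proof.
split; rewrite /dual_yd /=; try diagram_hom.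
- rewrite /dual_act; diagram (pair_mul_l hk) | (esym (coact_comul hX)).
- rewrite /dual_act; diagram (pair_one_l hk, coact_counit hX).
- diagram (dual_rcoact_comul).
- diagram (dual_rcoact_counit).
- exact: dual_rcoact_yd.
Qed.
End OneModule.
End Transport.

(** * The monoidal constraint *)

Section Tens.
Variables (C : braided_category) (A  : bialg C) (SA TA : Mor C).
Hypothesis hA : hopf_with A SA TA.

Lemma yd_tens_is_yd (X Y : yd C) : is_yd A X -> is_yd A Y -> is_yd A (yd_tens A X Y).
Proof.
move=> hX hY; split; rewrite /=; try diagram_hom.
- diagram (comul_mul hA, act_mul hX, act_mul hY).
- diagram (comul_one hA, act_one hX, act_one hY).
- diagram (comul_mul hA, coact_comul hX, coact_comul hY).
- diagram (counit_mul hA, coact_counit hX, coact_counit hY).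
- diagram_rhs (mul_assoc hA, comul_coassoc hA, esym (yd_condition hY),
    esym (mul_assoc hA), esym (comul_coassoc hA), esym (yd_condition hX),
    comul_coassoc hA, mul_assoc hA).
Qed.
End Tens.

Section Constraint.
Variables (C : braided_category) (A B : bialg C) (SA TA SB TB k k' : Mor C).
Hypothesis hA : hopf_with A SA TA.
Hypothesis hB : hopf_with B SB TB.
Hypothesis hk : pairing_with B A k k'.

(** The monoidal constraint of the functor, written with the right action: it lets the
    coaction of the second factor act on the first one. *)
Definition constraint (X Y : yd C) : Mor C := (ract A X ⊗ idm Y) ∘ (idm X ⊗ coact Y).
Definition constraint_inv (X Y : yd C) : Mor C :=
  (ract A X ⊗ idm Y) ∘ (idm X ⊗ TA ⊗ idm Y) ∘ (idm X ⊗ coact Y).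

Lemma ract_tens (X Y : yd C) : is_yd A X -> is_yd A Y ->
  ract A (yd_tens A X Y) =
  (ract A X ⊗ ract A Y) ∘ (idm X ⊗ inv (br A Y) ⊗ idm A) ∘ (idm (X ⊠ Y) ⊗ comul A).
Proof. move=> hX hY. rewrite /ract; diagram. Qed.

Section Two.
Variables X Y : yd C.
Hypothesis hX : is_yd A X.
Hypothesis hY : is_yd A Y.

Lemma constraint_hom : constraint X Y ∈ X ⊠ Y ⟶ X ⊠ Y.
Proof. rewrite /constraint; diagram_hom. Qed.

Lemma constraint_inv_hom : constraint_inv X Y ∈ X ⊠ Y ⟶ X ⊠ Y.
Proof. rewrite /constraint_inv; diagram_hom. Qed.

Lemma Omega2E : Omega2 A X Y = constraint X Y.
Proof. rewrite /Omega2 /yd_br /constraint /ract. diagram. Qed.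

Lemma constraintK : constraint_inv X Y ∘ constraint X Y = idm (X ⊠ Y).
Proof.
rewrite /constraint /constraint_inv.
diagram (esym (coact_comul hY), ract_mul hA hX, inv_antipode_r hA, ract_one hA hX,
  coact_counit hY).
Qed.

Lemma constraint_invK : constraint X Y ∘ constraint_inv X Y = idm (X ⊠ Y).
Proof.
rewrite /constraint /constraint_inv.
diagram (esym (coact_comul hY), ract_mul hA hX, inv_antipode_l hA, ract_one hA hX,
  coact_counit hY).
Qed.

(** The coaction of [B] on [X] creates, through [k'], the strand of [A] that pairs with the
    action of [B] on [Y]; the zigzag is straightened. *)
Lemma constraint_braided : yd_br B (dual_yd A B k k' X) (dual_yd A B k k' Y) = br X Y ∘ constraint X Y.
Proof. rewrite /yd_br /dual_yd /dual_act /dual_rcoact /constraint /=. diagram (snake_r hk). Qed.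

(** Both sides let [B] and the coactions act; they differ by the condition on the module
    [X].  Colinearity uses the condition on [Y]. *)
Lemma constraint_linear :
  constraint X Y ∘ act (yd_tens B (dual_yd A B k k' X) (dual_yd A B k k' Y)) =
  act (dual_yd A B k k' (yd_tens A X Y)) ∘ (idm B ⊗ constraint X Y).
Proof.
rewrite /dual_yd /dual_act /constraint /=.
diagram (esym (pair_mul_r hk), esym (coact_comul hY)) |
  (esym (coact_comul hY), esym (ract_yd hA hX)).
Qed.

Lemma coact_tens_dual :
  coact (yd_tens B (dual_yd A B k k' X) (dual_yd A B k k' Y)) =
  br (X ⊠ Y) B ∘ (ract A X ⊗ ract A Y ⊗ idm B) ∘ (idm X ⊗ br (Y ⊠ A) A ⊗ idm B) ∘
  (idm (X ⊠ Y) ⊗ ((comul A ⊗ idm B) ∘ k')).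
Proof.
rewrite /dual_yd /dual_rcoact /=.
diagram_rhs (copair_comul_l hB hA hk).
Qed.

Lemma constraint_colinear :
  coact (dual_yd A B k k' (yd_tens A X Y)) ∘ constraint X Y =
  (idm B ⊗ constraint X Y) ∘ coact (yd_tens B (dual_yd A B k k' X) (dual_yd A B k k' Y)).
Proof.
rewrite coact_tens_dual /dual_yd /dual_rcoact /= ract_tens // /constraint.
diagram (ract_mul hA hX) | (ract_mul hA hX, esym (ract_yd hA hY)).
Qed.

End Two.

(** The coherence of a monoidal functor, the objects being unchanged. *)
Lemma constraint_cocycle (X Y Z : yd C) : is_yd A X -> is_yd A Y -> is_yd A Z ->
  constraint (yd_tens A X Y) Z ∘ (constraint X Y ⊗ idm Z) = constraint X (yd_tens A Y Z) ∘ (idm X ⊗ constraint Y Z).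
Proof.
move=> hX hY hZ; rewrite /constraint ract_tens //=.
diagram (ract_mul hA hX) | (esym (coact_comul hZ), esym (ract_yd hA hY)).
Qed.

Lemma constraint_natural (X Y X' Y' : yd C) (f g : Mor C) :
  is_yd A X -> is_yd A Y -> is_yd A X' -> is_yd A Y' ->
  is_yd_morphism A X X' f -> is_yd_morphism A Y Y' g ->
  constraint X' Y' ∘ (f ⊗ g) = (f ⊗ g) ∘ constraint X Y.
Proof.
move=> hX hY hX' hY' [hf lf _] [hg _ cg]; rewrite /constraint /ract.
diagram (cg, esym lf).
Qed.

Lemma dual_yd_morphism (X Y : yd C) (f : Mor C) :
  is_yd A X -> is_yd A Y ->
  is_yd_morphism A X Y f -> is_yd_morphism B (dual_yd A B k k' X) (dual_yd A B k k' Y) f.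
Proof.
move=> hX hY [hf lf cf]; split=> //; rewrite /dual_yd /dual_act /dual_rcoact /ract /=.
- diagram_rhs (cf).
- diagram_rhs lf.
Qed.

Lemma yd_br_morphism (X Y : yd C) : is_yd A X -> is_yd A Y ->
  is_yd_morphism A (yd_tens A X Y) (yd_tens A Y X) (yd_br A X Y).
Proof.
move=> hX hY; split; rewrite /yd_br /=; try diagram_hom.
- diagram (esym (act_mul hY), esym (yd_condition hX)) | (esym (act_mul hY)).
- diagram (esym (coact_comul hX), esym (yd_condition hY)) | (esym (coact_comul hX)).
Qed.

End Constraint.

(** * The image of a Hopf algebra under the functor *)

Section Morphisms.
Variables (C : braided_category) (A : bialg C).

Lemma yd_morphism_comp (X Y Z : yd C) (f g : Mor C) :
  is_yd A X -> is_yd A Y -> is_yd A Z ->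
  is_yd_morphism A X Y f -> is_yd_morphism A Y Z g -> is_yd_morphism A X Z (g ∘ f).
Proof.
move=> hX hY hZ [hf lf cf] [hg lg cg]; split; first by diagram_hom.
- diagram (lf, lg).
- diagram (cg, cf).
Qed.

Lemma yd_morphism_inv (X Y : yd C) (f g : Mor C) :
  is_yd A X -> is_yd A Y -> g ∈ Y ⟶ X -> g ∘ f = idm X -> f ∘ g = idm Y ->
  is_yd_morphism A X Y f -> is_yd_morphism A Y X g.
Proof.
move=> hX hY hg gf fg [hf lf cf]; split=> //.
- transitivity (g ∘ act Y ∘ (idm A ⊗ f) ∘ (idm A ⊗ g)); first by diagram_rhs fg.
  diagram (esym lf, gf).
- transitivity ((idm A ⊗ g) ∘ (idm A ⊗ f) ∘ coact X ∘ g); first by diagram_rhs gf.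
  diagram (esym cf, fg).
Qed.
End Morphisms.

Section YDHopfTyping.
Variables (C : braided_category) (A : bialg C) (K : yd_bialg C).
Hypothesis hK : is_yd_hopf A K.
Lemma yd_act_hom : yd_act K ∈ A ⊠ K ⟶ K.
Proof. exact: act_hom (yd_hopf_yd hK). Qed.
Lemma yd_coact_hom : yd_coact K ∈ K ⟶ A ⊠ K.
Proof. exact: coact_hom (yd_hopf_yd hK). Qed.
Lemma yd_mul_hom : mul K ∈ K ⊠ K ⟶ K.
Proof. exact: mul_hom (yd_hopf_bialgebra hK). Qed.
Lemma yd_one_hom : one K ∈ unitO ⟶ K.
Proof. exact: one_hom (yd_hopf_bialgebra hK). Qed.
Lemma yd_comul_hom : comul K ∈ K ⟶ K ⊠ K.
Proof. exact: comul_hom (yd_hopf_bialgebra hK). Qed.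
Lemma yd_counit_hom : counit K ∈ K ⟶ unitO.
Proof. exact: counit_hom (yd_hopf_bialgebra hK). Qed.
End YDHopfTyping.
#[export] Hint Resolve yd_act_hom yd_coact_hom yd_mul_hom yd_one_hom yd_comul_hom yd_counit_hom : hom.

Section Hopf.
Variables (C : braided_category) (A B : bialg C) (SA TA SB TB k k' : Mor C).
Hypothesis hA : hopf_with A SA TA.
Hypothesis hB : hopf_with B SB TB.
Hypothesis hk : pairing_with B A k k'.
Variable K : yd_bialg C.
Hypothesis hK : is_yd_hopf A K.
Local Notation X := (yd_mod K).
Let hX : is_yd A X := yd_hopf_yd hK.
Let hKb := yd_hopf_bialgebra hK.
Local Notation XX := (yd_tens A X X).
Let hXX : is_yd A XX := yd_tens_is_yd hA hX hX.

Definition dual_yd_bialg : yd_bialg C := YDBialg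
  (Bialg K (mul K ∘ constraint A X X) (one K) (constraint_inv A TA X X ∘ comul K) (counit K))
  (act (dual_yd A B k k' X)) (coact (dual_yd A B k k' X)).

Let e := constraint A X X.
Let ei := constraint_inv A TA X X.

Let e_hom : e ∈ X ⊠ X ⟶ X ⊠ X := constraint_hom hX hX.
Let ei_hom : ei ∈ X ⊠ X ⟶ X ⊠ X := constraint_inv_hom hA hX hX.
Hint Resolve e_hom ei_hom : hom.

Local Notation OX := (dual_yd A B k k' X).
Let hOX : is_yd B OX := dual_is_yd hA hB hk hX.
Let hOXX : is_yd B (dual_yd A B k k' XX) := dual_is_yd hA hB hk hXX.
Let hOXOX : is_yd B (yd_tens B OX OX) := yd_tens_is_yd hB hOX hOX.

Lemma e_morphism : is_yd_morphism B (yd_tens B OX OX) (dual_yd A B k k' XX) e.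
Proof.
split; first exact: e_hom.
- exact: (constraint_linear hA hB hk hX hX).
- exact: (constraint_colinear hA hB hk hX hX).
Qed.

Lemma ei_morphism : is_yd_morphism B (dual_yd A B k k' XX) (yd_tens B OX OX) ei.
Proof.
apply: (yd_morphism_inv hOXOX hOXX ei_hom) e_morphism.
  exact: (constraintK hA hX hX).
exact: (constraint_invK hA hX hX).
Qed.

Lemma dual_hopf_mul : is_yd_morphism B (yd_tens B OX OX) OX (mul K ∘ e).
Proof.
apply: (yd_morphism_comp hOXOX hOXX hOX e_morphism).
exact: (dual_yd_morphism hk hXX hX (yd_hopf_mul hK)).
Qed.

Lemma dual_hopf_comul : is_yd_morphism B OX (yd_tens B OX OX) (ei ∘ comul K).
Proof.
apply: (yd_morphism_comp hOX hOXX hOXOX _ ei_morphism).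
exact: (dual_yd_morphism hk hX hXX (yd_hopf_comul hK)).
Qed.

Lemma dual_hopf_one : is_yd_morphism B (yd_unit B) OX (one K).
Proof.
have [h l c] := yd_hopf_one hK; split=> //; rewrite /dual_yd /dual_act /dual_rcoact /ract /=.
- diagram_rhs (c, pair_one_r hk).
- diagram (esym l, copair_counit_l hB hA hk).
Qed.

Lemma dual_hopf_counit : is_yd_morphism B OX (yd_unit B) (counit K).
Proof.
have [h l c] := yd_hopf_counit hK; split=> //; rewrite /dual_yd /dual_act /dual_rcoact /ract /=.
- diagram (esym c, pair_one_r hk).
- diagram_rhs (l, copair_counit_l hB hA hk).
Qed.

(* The axioms without units use the constraint only through its naturality and its
   coherence, so it is treated as a box for them; [e21], for instance, is the constraint of a
   tensor square and [X]. *)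
Let e21 := constraint A XX X.
Let e12 := constraint A X XX.
Let e22 := constraint A XX XX.
Let e13 := constraint A X (yd_tens A X XX).
Let e21i := constraint_inv A TA XX X.
Let e12i := constraint_inv A TA X XX.
Let e22i := constraint_inv A TA XX XX.
Let b := yd_br A X X.

Let id_morphism : is_yd_morphism A X X (idm X).
Proof. split; [exact: hom_idm | by diagram | by diagram]. Qed.

Let e21_hom : e21 ∈ X ⊠ X ⊠ X ⟶ X ⊠ X ⊠ X.
Proof. by rewrite /e21 /constraint /ract /=; diagram_hom. Qed.
Let e12_hom : e12 ∈ X ⊠ X ⊠ X ⟶ X ⊠ X ⊠ X.
Proof. by rewrite /e12 /constraint /ract /=; diagram_hom. Qed.
Let e22_hom : e22 ∈ X ⊠ X ⊠ X ⊠ X ⟶ X ⊠ X ⊠ X ⊠ X.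
Proof. by rewrite /e22 /constraint /ract /=; diagram_hom. Qed.
Let e13_hom : e13 ∈ X ⊠ X ⊠ X ⊠ X ⟶ X ⊠ X ⊠ X ⊠ X.
Proof. by rewrite /e13 /constraint /ract /=; diagram_hom. Qed.
Let e21i_hom : e21i ∈ X ⊠ X ⊠ X ⟶ X ⊠ X ⊠ X.
Proof. by rewrite /e21i /constraint_inv /ract /=; diagram_hom. Qed.
Let e12i_hom : e12i ∈ X ⊠ X ⊠ X ⟶ X ⊠ X ⊠ X.
Proof. by rewrite /e12i /constraint_inv /ract /=; diagram_hom. Qed.
Let e22i_hom : e22i ∈ X ⊠ X ⊠ X ⊠ X ⟶ X ⊠ X ⊠ X ⊠ X.
Proof. by rewrite /e22i /constraint_inv /ract /=; diagram_hom. Qed.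
Let b_hom : b ∈ X ⊠ X ⟶ X ⊠ X.
Proof. by rewrite /b /yd_br; diagram_hom. Qed.

Let mul_l : e ∘ (mul K ⊗ idm X) = (mul K ⊗ idm X) ∘ e21.
Proof. exact: (constraint_natural hXX hX hX hX (yd_hopf_mul hK) id_morphism). Qed.
Let mul_r : e ∘ (idm X ⊗ mul K) = (idm X ⊗ mul K) ∘ e12.
Proof. exact: (constraint_natural hX hXX hX hX id_morphism (yd_hopf_mul hK)). Qed.
Let mul_lr : e ∘ (mul K ⊗ mul K) = (mul K ⊗ mul K) ∘ e22.
Proof. exact: (constraint_natural hXX hXX hX hX (yd_hopf_mul hK) (yd_hopf_mul hK)). Qed.
Let comul_l : e21 ∘ (comul K ⊗ idm X) = (comul K ⊗ idm X) ∘ e.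
Proof. exact: (constraint_natural hX hX hXX hX (yd_hopf_comul hK) id_morphism). Qed.
Let comul_r : e12 ∘ (idm X ⊗ comul K) = (idm X ⊗ comul K) ∘ e.
Proof. exact: (constraint_natural hX hX hX hXX id_morphism (yd_hopf_comul hK)). Qed.
Let comul_lr : e22 ∘ (comul K ⊗ comul K) = (comul K ⊗ comul K) ∘ e.
Proof. exact: (constraint_natural hX hX hXX hXX (yd_hopf_comul hK) (yd_hopf_comul hK)). Qed.
Let cocycle : e21 ∘ (e ⊗ idm X) = e12 ∘ (idm X ⊗ e) := constraint_cocycle hA hX hX hX.
Let cocycle4 : e22 ∘ (e ⊗ idm XX) = e13 ∘ (idm X ⊗ e12) := constraint_cocycle hA hX hX hXX.
Let eK : ei ∘ e = idm (X ⊠ X) := constraintK hA hX hX.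
Let eiK : e ∘ ei = idm (X ⊠ X) := constraint_invK hA hX hX.
Let e21K : e21i ∘ e21 = idm (X ⊠ X ⊠ X).
Proof. by rewrite tensO_assoc; exact: (constraintK hA hXX hX). Qed.
Let e12K : e12i ∘ e12 = idm (X ⊠ X ⊠ X) := constraintK hA hX hXX.
Let e22K : e22i ∘ e22 = idm (X ⊠ X ⊠ X ⊠ X).
Proof. by rewrite tensO_assoc; exact: (constraintK hA hXX hXX). Qed.
Let br_e : b = e ∘ br X X.
Proof. rewrite /b /yd_br /e /constraint /ract; diagram. Qed.

Lemma comul_l_inv : (comul K ⊗ idm X) ∘ ei = e21i ∘ (comul K ⊗ idm X).
Proof.
transitivity (e21i ∘ e21 ∘ (comul K ⊗ idm X) ∘ ei); first by diagram_rhs e21K.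
diagram (comul_l, eiK).
Qed.

Lemma comul_r_inv : (idm X ⊗ comul K) ∘ ei = e12i ∘ (idm X ⊗ comul K).
Proof.
transitivity (e12i ∘ e12 ∘ (idm X ⊗ comul K) ∘ ei); first by diagram_rhs e12K.
diagram (comul_r, eiK).
Qed.

Lemma cocycle_inv : (ei ⊗ idm X) ∘ e21i = (idm X ⊗ ei) ∘ e12i.
Proof.
have h21 : e21 ∘ e21i = idm (X ⊠ X ⊠ X).
  by rewrite tensO_assoc; exact: (constraint_invK hA hXX hX).
transitivity ((idm X ⊗ ei) ∘ e12i ∘ e12 ∘ (idm X ⊗ e) ∘ (ei ⊗ idm X) ∘ e21i).
  diagram_rhs (e12K, eK).
diagram (esym cocycle, eiK, h21).
Qed.

(** By coherence the constraint of four factors is composed of [e13] and of constraints of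
    fewer factors; the middle braiding commutes with [e13] because it is a morphism of
    Yetter-Drinfel'd modules. *)
Lemma b_e13 : (idm X ⊗ b ⊗ idm X) ∘ e13 = e13 ∘ (idm X ⊗ b ⊗ idm X).
Proof.
have [_ _ cb] := yd_br_morphism hA hX hX.
rewrite -/b in cb; rewrite /e13 /constraint /=.
diagram (esym (mul_assoc hA)) | (esym (mul_assoc hA), cb).
Qed.

Lemma b_e21 : (b ⊗ idm X) ∘ e21 = e21 ∘ (b ⊗ idm X).
Proof. by rewrite (constraint_natural hXX hX hXX hX (yd_br_morphism hA hX hX) id_morphism). Qed.

(** The left side appears when the comultiplication is applied to a product in [K], the
    right side is what the same axiom requires in the image of [K], whose braiding is
    [br X X ∘ e]. *)
Lemma braid_constraint :
  e22i ∘ (idm X ⊗ b ⊗ idm X) ∘ e22 = (e ⊗ e) ∘ (idm X ⊗ (br X X ∘ e) ⊗ idm X) ∘ (ei ⊗ ei).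
Proof.
transitivity (e22i ∘ (idm X ⊗ b ⊗ idm X) ∘ e22 ∘ (e ⊗ e) ∘ (ei ⊗ ei)).
  diagram_rhs (eiK, eiK).
transitivity (e22i ∘ e22 ∘ (e ⊗ e) ∘ (idm X ⊗ (br X X ∘ e) ⊗ idm X) ∘ (ei ⊗ ei)).
  diagram (cocycle4, esym cocycle, b_e13, b_e21, br_e) | (cocycle4, esym cocycle).
diagram (e22K).
Qed.

Lemma dual_hopf_bialgebra : is_bialgebra (yd_br B OX OX) dual_yd_bialg.
Proof.
have [_ lu cu] := yd_hopf_one hK; have [_ lc cc] := yd_hopf_counit hK.
have one_l : e ∘ (one K ⊗ idm X) = one K ⊗ idm X.
  rewrite /e /constraint /ract; diagram (esym lu, coact_counit hX).
have one_r : e ∘ (idm X ⊗ one K) = idm X ⊗ one K.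
  rewrite /e /constraint; diagram (cu, ract_one hA hX).
have counit_l : (counit K ⊗ idm X) ∘ e = counit K ⊗ idm X.
  rewrite /e /constraint /ract; diagram (lc, coact_counit hX).
have counit_r : (idm X ⊗ counit K) ∘ e = idm X ⊗ counit K.
  rewrite /e /constraint; diagram (esym cc, ract_one hA hX).
have counit_li : (counit K ⊗ idm X) ∘ ei = counit K ⊗ idm X by diagram (esym counit_l, eiK).
have counit_ri : (idm X ⊗ counit K) ∘ ei = idm X ⊗ counit K by diagram (esym counit_r, eiK).
have one_li : ei ∘ (one K ⊗ idm X) = one K ⊗ idm X.
  transitivity (ei ∘ e ∘ (one K ⊗ idm X)); first by diagram_rhs one_l.
  diagram (eK).
have mul_lr_inv : ei ∘ (mul K ⊗ mul K) = (mul K ⊗ mul K) ∘ e22i.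
  have h22 : e22 ∘ e22i = idm (X ⊠ X ⊠ X ⊠ X).
    by rewrite tensO_assoc; exact: (constraint_invK hA hXX hXX).
  transitivity (ei ∘ (mul K ⊗ mul K) ∘ e22 ∘ e22i); first by diagram_rhs h22.
  diagram (esym mul_lr, eK).
have hb : yd_br B OX OX = br X X ∘ e := constraint_braided hk hX hX.
have hKm := comul_mul hKb; rewrite -/b in hKm.
split; rewrite ?hb /= -/e -/ei; try diagram_hom.
- diagram (mul_l, cocycle, mul_assoc hKb) | (mul_r).
- diagram (one_l, mul_one_l hKb).
- diagram (one_r, mul_one_r hKb).
- diagram (comul_l_inv, cocycle_inv, comul_coassoc hKb) | (comul_r_inv).
- diagram (counit_li, counit_comul_l hKb).
- diagram (counit_ri, counit_comul_r hKb).
- diagram (hKm, mul_lr_inv, esym comul_lr, braid_constraint).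
- diagram (counit_mul hKb, counit_l).
- diagram (comul_one hKb, one_li).
- exact: counit_one hKb.
Qed.

(** The antipode of [K] serves again: being a morphism, it passes the constraint. *)
Lemma dual_hopf_antipode S : is_yd_morphism A X X S -> is_antipode K S ->
  is_yd_morphism B OX OX S /\ is_antipode dual_yd_bialg S.
Proof.
move=> mS [hS iS Sl Sr]; split; first exact: (dual_yd_morphism hk hX hX mS).
split=> //=; rewrite -/e -/ei.
- have n : e ∘ (S ⊗ idm X) = (S ⊗ idm X) ∘ e := constraint_natural hX hX hX hX mS id_morphism.
  diagram (n, eiK, Sl).
- have n : e ∘ (idm X ⊗ S) = (idm X ⊗ S) ∘ e := constraint_natural hX hX hX hX id_morphism mS.
  diagram (n, eiK, Sr).
Qed.

Theorem dual_yd_hopf : is_yd_hopf B dual_yd_bialg.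
Proof.
split.
- exact: hOX.
- exact: dual_hopf_mul.
- exact: dual_hopf_one.
- exact: dual_hopf_comul.
- exact: dual_hopf_counit.
- exact: dual_hopf_bialgebra.
- by have [S [mS aS]] := yd_hopf_antipode hK; exists S; exact: dual_hopf_antipode.
Qed.

End Hopf.

(** * The biproduct is a Hopf algebra *)

Section Biproduct.
Variables (C : braided_category) (A : bialg C) (SA TA : Mor C).
Hypothesis hA : hopf_with A SA TA.
Variable K : yd_bialg C.
Hypothesis hK : is_yd_hopf A K.
Local Notation X := (yd_mod K).
Let hX : is_yd A X := yd_hopf_yd hK.
Let hKb := yd_hopf_bialgebra hK.
Local Notation H := (biproduct A K).

(* [lm] and [cm] say that the multiplication of [K] is linear and colinear, [lc] and [cc]
   the same for the comultiplication, [l1], [c1] for the unit and [le], [ce] for the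
   counit. *)

Lemma biproduct_mul_assoc : mul H ∘ (mul H ⊗ idm H) = mul H ∘ (idm H ⊗ mul H).
Proof.
have [_ lm _] := yd_hopf_mul hK.
rewrite /=.
diagram (comul_mul hA, act_mul hX,
  exhaust (mul_assoc hA, mul_assoc hKb, comul_coassoc hA)) |
  (esym lm, exhaust (mul_assoc hA, mul_assoc hKb, comul_coassoc hA)).
Qed.

Lemma biproduct_comul_coassoc : (comul H ⊗ idm H) ∘ comul H = (idm H ⊗ comul H) ∘ comul H.
Proof.
have [_ _ cm] := yd_hopf_comul hK.
rewrite /=.
diagram (comul_mul hA, coact_comul hX,
  exhaust (mul_assoc hA, comul_coassoc hKb, comul_coassoc hA)) |
  (esym cm, exhaust (mul_assoc hA, comul_coassoc hKb, comul_coassoc hA)).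
Qed.

(** After [comul_mul] in [A] and in [K] the braiding of Yetter-Drinfel'd modules brings an
    action and a coaction; the condition relating them produces the braiding of the
    right side. *)
Lemma biproduct_comul_mul : comul H ∘ mul H =
  (mul H ⊗ mul H) ∘ (idm H ⊗ br H H ⊗ idm H) ∘ (comul H ⊗ comul H).
Proof.
have [_ lm cm] := yd_hopf_mul hK.
have [_ lc cc] := yd_hopf_comul hK.
have hKm := comul_mul hKb; rewrite /yd_br in hKm.
rewrite /=.
(* The diagrams are large, and hardly any isotopy is needed to find the next occurrence, so
   only few isotopic diagrams are tried. *)
diagram_with 5 (comul_mul hA, hKm, lc, cm, exhaust (comul_mul hA, mul_assoc hA, comul_coassoc hA),
  esym (comul_coassoc hA), esym (mul_assoc hA), esym (yd_condition hX),
  exhaust (act_mul hX, mul_assoc hA, comul_coassoc hA)) |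
  (exhaust (act_mul hX, comul_mul hA, coact_comul hX, mul_assoc hA, comul_coassoc hA)).
Qed.

Lemma biproduct_bialgebra : is_bialgebra (br H H) H.
Proof.
have [_ l1 c1] := yd_hopf_one hK; have [_ le ce] := yd_hopf_counit hK.
have [_ lm cm] := yd_hopf_mul hK; have [_ lc cc] := yd_hopf_comul hK.
split; [by rewrite /=; diagram_hom .. | exact: biproduct_mul_assoc | | |
  exact: biproduct_comul_coassoc | | | exact: biproduct_comul_mul | | |]; rewrite /=.
- diagram (comul_one hA, exhaust (act_one hX, unit_laws hA, unit_laws hKb)).
- diagram (esym l1, exhaust (unit_laws hA, unit_laws hKb)).
- diagram (counit_mul hA, coact_counit hX, exhaust (unit_laws hA, unit_laws hKb)).
- diagram (esym ce, exhaust (unit_laws hA, unit_laws hKb)).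
- diagram (counit_mul hKb, counit_mul hA, le, exhaust (unit_laws hA)).
- diagram (comul_one hKb, comul_one hA, c1, exhaust (unit_laws hA)).
- diagram (counit_one hKb, counit_one hA).
Qed.

End Biproduct.

Section Biproduct.
Variables (C : braided_category) (A : bialg C) (SA TA : Mor C).
Hypothesis hA : hopf_with A SA TA.
Variable K : yd_bialg C.
Hypothesis hK : is_yd_hopf A K.
Local Notation X := (yd_mod K).
Let hX : is_yd A X := yd_hopf_yd hK.
Local Notation H := (biproduct A K).

Variables SK TK : Mor C.
Hypothesis hSK : is_yd_morphism A X X SK.
Hypothesis SK_hom : SK ∈ K ⟶ K.
Hypothesis TK_hom : TK ∈ K ⟶ K.
Hypothesis TSK : TK ∘ SK = idm K.
Hypothesis STK : SK ∘ TK = idm K.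
Hypothesis SK_l : mul K ∘ (SK ⊗ idm K) ∘ comul K = one K ∘ counit K.
Hypothesis SK_r : mul K ∘ (idm K ⊗ SK) ∘ comul K = one K ∘ counit K.

(** The antipode of the biproduct is the product of the antipodes of the factors up to the
    order: [psi] applies the coaction of [K] and multiplies, [phi] acts on [K] with the
    comultiplication of [A].  Both are invertible by the inverse antipode of [A], which
    makes the antipode invertible. *)
Let psi := (mul A ⊗ idm K) ∘ (idm A ⊗ br K A) ∘ (yd_coact K ⊗ idm A).
Let psi_inv := (idm K ⊗ mul A) ∘ (inv (br K A) ⊗ idm A) ∘ (TA ⊗ idm (K ⊠ A)) ∘
  (yd_coact K ⊗ idm A) ∘ inv (br K A).
Let phi := (yd_act K ⊗ idm A) ∘ (idm A ⊗ br A K) ∘ (comul A ⊗ idm K).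
Let phi_inv := inv (br A K) ∘ (yd_act K ⊗ idm A) ∘ (TA ⊗ idm (K ⊠ A)) ∘
  (inv (br A K) ⊗ idm A) ∘ (idm K ⊗ comul A).

Lemma psiK : psi_inv ∘ psi = idm (K ⊠ A).
Proof.
rewrite /psi /psi_inv.
diagram (esym (mul_assoc hA), esym (coact_comul hX), inv_antipode_r hA, coact_counit hX,
  mul_one_l hA).
Qed.

Lemma psi_invK : psi ∘ psi_inv = idm (A ⊠ K).
Proof.
rewrite /psi /psi_inv.
diagram (esym (mul_assoc hA), esym (coact_comul hX), inv_antipode_l hA, coact_counit hX,
  mul_one_l hA).
Qed.

Lemma phiK : phi_inv ∘ phi = idm (A ⊠ K).
Proof.
rewrite /phi /phi_inv.
diagram (esym (act_mul hX), esym (comul_coassoc hA), inv_antipode_r hA,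
  counit_comul_l hA, act_one hX).
Qed.

Lemma phi_invK : phi ∘ phi_inv = idm (K ⊠ A).
Proof.
rewrite /phi /phi_inv.
diagram (esym (act_mul hX), esym (comul_coassoc hA), inv_antipode_l hA,
  counit_comul_l hA, act_one hX).
Qed.

Definition biproduct_antipode := phi ∘ (SA ⊗ SK) ∘ psi.
Definition biproduct_inv_antipode := psi_inv ∘ (TA ⊗ TK) ∘ phi_inv.

Lemma biproduct_antipode_l : mul H ∘ (biproduct_antipode ⊗ idm H) ∘ comul H = one H ∘ counit H.
Proof.
have [_ lm cm] := yd_hopf_mul hK; have [_ lc cc] := yd_hopf_comul hK.
have [_ l1 c1] := yd_hopf_one hK; have [_ le ce] := yd_hopf_counit hK.
rewrite /biproduct_antipode /phi /psi /=.
diagram (esym (comul_coassoc hA), lm, esym (mul_assoc hA), cc, SK_l, esym l1, esym ce,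
  exhaust (unit_laws hA), antipode_l hA).
Qed.

Lemma biproduct_antipode_r : mul H ∘ (idm H ⊗ biproduct_antipode) ∘ comul H = one H ∘ counit H.
Proof.
have [_ lm cm] := yd_hopf_mul hK; have [_ lc cc] := yd_hopf_comul hK.
have [_ l1 c1] := yd_hopf_one hK; have [_ le ce] := yd_hopf_counit hK.
rewrite /biproduct_antipode /phi /psi /=.
diagram (esym (coact_comul hX), esym (comul_mul hA), esym (act_mul hX),
  esym (comul_mul hA), antipode_r hA, comul_one hA,
  exhaust (counit_mul hA, act_one hX, coact_counit hX), SK_r).
Qed.

Lemma biproduct_antipodeP : is_antipode H biproduct_antipode.
Proof.
have hphi : phi ∈ A ⊠ K ⟶ K ⊠ A by rewrite /phi; diagram_hom.
have hpsi : psi ∈ K ⊠ A ⟶ A ⊠ K by rewrite /psi; diagram_hom.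
have hphi' : phi_inv ∈ K ⊠ A ⟶ A ⊠ K by rewrite /phi_inv; diagram_hom.
have hpsi' : psi_inv ∈ A ⊠ K ⟶ K ⊠ A by rewrite /psi_inv; diagram_hom.
have h : biproduct_antipode ∈ H ⟶ H by rewrite /biproduct_antipode; diagram_hom.
split=> //; [|exact: biproduct_antipode_l|exact: biproduct_antipode_r].
exists biproduct_inv_antipode; rewrite /is_inverse; have [-> ->] := h.
rewrite /biproduct_inv_antipode /biproduct_antipode; split; first by diagram_hom.
split.
- diagram (phiK, antipodeK hA, TSK, psiK).
- diagram (psi_invK, inv_antipodeK hA, STK, phi_invK).
Qed.
End Biproduct.

Theorem biproduct_hopf (C : braided_category) (A : bialg C) (SA TA : Mor C) (K : yd_bialg C) :
  hopf_with A SA TA -> is_yd_hopf A K -> is_hopf (biproduct A K).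
Proof.
move=> hA hK; split; first exact: (biproduct_bialgebra hA hK).
have [S [mS [hS iS Sl Sr]]] := yd_hopf_antipode hK.
have [T [hT [TS ST]]] := iS; have [dS cS] := hS; rewrite dS cS in hT TS ST.
by exists (biproduct_antipode A SA K S); exact: (biproduct_antipodeP hA hK hS hT TS ST Sl Sr).
Qed.

Section Pieces.
Variables (C : braided_category) (A : bialg C) (SA TA : Mor C).
Hypothesis hA : hopf_with A SA TA.
Variable K : yd_bialg C.
Hypothesis hK : is_yd_hopf A K.
Local Notation X := (yd_mod K).
Let hX : is_yd A X := yd_hopf_yd hK.
Let hKb := yd_hopf_bialgebra hK.
Local Notation H := (biproduct A K).

Lemma biproduct_proj : is_hopf_morphism H A (counit K ⊗ idm A).
Proof.
have [_ le ce] := yd_hopf_counit hK.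
split; rewrite /=; first by diagram_hom.
- diagram (counit_mul hKb, le, counit_comul_l hA).
- diagram (counit_one hKb).
- diagram_rhs (counit_comul_l hKb, esym ce, exhaust (mul_one_l hA)).
- diagram.
Qed.

Lemma biproduct_incl : is_hopf_morphism A H (one K ⊗ idm A).
Proof.
have [_ l1 c1] := yd_hopf_one hK.
split; rewrite /=; first by diagram_hom.
- diagram_rhs (esym l1, counit_comul_l hA, mul_one_l hKb).
- diagram.
- diagram (comul_one hKb, c1, mul_one_l hA).
- diagram (counit_one hKb).
Qed.

Lemma biproduct_split : (counit K ⊗ idm A) ∘ (one K ⊗ idm A) = idm A.
Proof. diagram (counit_one hKb). Qed.

(** The projection of [comul H] to [A] on the right factor is [comul A]; an arrow coinvariant
    for it is recovered by applying the counit of [A]. *)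
Lemma biproduct_coinvariants : is_equalizer
  ((idm H ⊗ (counit K ⊗ idm A)) ∘ comul H) (idm H ⊗ one A) (idm K ⊗ one A).
Proof.
have [_ le ce] := yd_hopf_counit hK.
have hm := comul_hom (biproduct_bialgebra hA hK).
have h1 : (idm H ⊗ (counit K ⊗ idm A)) ∘ comul H ∈ H ⟶ H ⊠ A by rewrite /=; diagram_hom.
have h2 : idm H ⊗ one A ∈ H ⟶ H ⊠ A by rewrite /=; diagram_hom.
have h3 : idm K ⊗ one A ∈ K ⟶ H by rewrite /=; diagram_hom.
have e0 : (idm H ⊗ (counit K ⊗ idm A)) ∘ comul H = idm K ⊗ comul A.
  rewrite /=; diagram (esym ce, exhaust (counit_comul_r hKb, mul_one_l hA)).
have [d1 c1] := h1; have [d2 c2] := h2; have [d3 c3] := h3.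
split; rewrite ?d1 ?c1 ?d2 ?c2 ?c3 //.
  by rewrite e0 /=; diagram (comul_one hA).
move=> h ch e; rewrite e0 in e.
have hh : h ∈ dom h ⟶ K ⊠ A by [].
exists ((idm K ⊗ counit A) ∘ h); split.
- split; first by rewrite d3; diagram_hom.
  transitivity ((idm K ⊗ counit A ⊗ idm A) ∘ ((idm (biproduct A K) ⊗ one A) ∘ h)).
    by rewrite /=; diagram.
  rewrite -e; diagram (counit_comul_l hA).
- move=> u [hu <-]; rewrite d3 in hu. diagram (counit_one hA).
Qed.
End Pieces.

(** * The isomorphism theta *)

Section Theta.
Variables (C : braided_category) (A : bialg C) (SA TA : Mor C).
Hypothesis hA : hopf_with A SA TA.

Definition yd_theta (X : yd C) : Mor C := act X ∘ (SA ⊗ idm X) ∘ coact X.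

Section One.
Variable X : yd C.
Hypothesis hX : is_yd A X.

Lemma yd_theta_hom : yd_theta X ∈ X ⟶ X. Proof. rewrite /yd_theta; diagram_hom. Qed.
Hint Resolve yd_theta_hom : hom.

(** In Sweedler's notation and up to braidings, [S a2 . theta (a1 x) = eps a . theta x].
    The coaction of [a1 x] times [a2] occurs on the right side of the condition on
    Yetter-Drinfel'd modules; on the left side of the condition the antipode makes the
    factors [a1] and [a2] cancel. *)
Lemma yd_theta_act_counit :
  act X ∘ (SA ⊗ yd_theta X) ∘ br X A ∘ (act X ⊗ idm A) ∘ (idm A ⊗ br A X) ∘ (comul A ⊗ idm X) =
  counit A ⊗ yd_theta X.
Proof.
transitivity (act X ∘ (SA ⊗ idm X) ∘ ((mul A ⊗ idm X) ∘ (idm A ⊗ br X A) ∘ (coact X ⊗ idm A) ∘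
   (act X ⊗ idm A) ∘ (idm A ⊗ br A X) ∘ (comul A ⊗ idm X))); rewrite /yd_theta.
  diagram_rhs (antipode_mul hA, act_mul hX).
rewrite -(yd_condition hX).
diagram (antipode_mul hA, esym (act_mul hX), mul_assoc hA, antipode_l hA, mul_one_r hA).
Qed.

(** The same for the coaction. *)
Lemma yd_theta_coact_unit :
  (mul A ⊗ idm X) ∘ (idm A ⊗ br X A) ∘ ((coact X ∘ yd_theta X) ⊗ SA) ∘ br A X ∘ coact X =
  one A ⊗ yd_theta X.
Proof.
transitivity (((mul A ⊗ idm X) ∘ (idm A ⊗ br X A) ∘ (coact X ⊗ idm A) ∘
   (act X ⊗ idm A) ∘ (idm A ⊗ br A X) ∘ (comul A ⊗ idm X)) ∘ (SA ⊗ idm X) ∘ coact X);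
  rewrite /yd_theta.
  diagram_rhs (antipode_comul hA, coact_comul hX).
rewrite -(yd_condition hX).
diagram (antipode_comul hA, esym (coact_comul hX), comul_coassoc hA, antipode_l hA,
  counit_comul_r hA).
Qed.

(** So [theta] twists the action by the square of the antipode and by the double braiding:
    in [yd_theta_act_counit] the factor [S a2] is moved to the other side. *)
Lemma yd_theta_act : yd_theta X ∘ act X = act X ∘ ((SA ∘ SA) ⊗ yd_theta X) ∘ br X A ∘ br A X.
Proof.
(* [theta (a x)] is [S (a2 (S a3)) . theta (a1 x)], and this [S] is anti-multiplicative. *)
transitivity (act X ∘ ((SA ∘ mul A ∘ (idm A ⊗ SA)) ⊗ yd_theta X) ∘ br X (A ⊠ A) ∘
  (act X ⊗ idm (A ⊠ A)) ∘ (idm A ⊗ br (A ⊠ A) X) ∘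
  (((idm A ⊗ comul A) ∘ comul A) ⊗ idm X)).
  diagram_rhs (antipode_r hA, counit_comul_r hA, antipode_one hA, act_one hX).
diagram (antipode_mul hA, act_mul hX, esym (comul_coassoc hA), yd_theta_act_counit,
  counit_comul_l hA).
Qed.

Lemma yd_theta_coact : coact X ∘ yd_theta X = br X A ∘ br A X ∘ ((SA ∘ SA) ⊗ yd_theta X) ∘ coact X.
Proof.
transitivity ((mul A ⊗ idm X) ∘ (idm A ⊗ br X A) ∘
  ((coact X ∘ yd_theta X) ⊗ (SA ∘ mul A ∘ (SA ⊗ idm A))) ∘
  br (A ⊠ A) X ∘ (comul A ⊗ idm X) ∘ coact X).
  diagram_rhs (antipode_l hA, coact_counit hX, antipode_one hA, mul_one_r hA).
diagram (antipode_mul hA, coact_comul hX, esym (mul_assoc hA), yd_theta_coact_unit,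
  mul_one_l hA).
Qed.

(** The coaction followed by the twisted action that [yd_theta_act] turns into the action. *)
Definition yd_theta_inv : Mor C :=
  act X ∘ inv (br A X) ∘ inv (br X A) ∘ ((TA ∘ TA) ⊗ idm X) ∘ coact X.

Lemma yd_theta_invK : yd_theta X ∘ yd_theta_inv = idm X.
Proof.
transitivity (act X ∘ (idm A ⊗ yd_theta X) ∘ coact X).
  rewrite /yd_theta_inv; diagram (yd_theta_act, exhaust (inv_antipodeK hA)).
rewrite /yd_theta; diagram (esym (act_mul hX), esym (coact_comul hX), antipode_r hA,
  coact_counit hX, act_one hX).
Qed.

Lemma yd_thetaK : yd_theta_inv ∘ yd_theta X = idm X.
Proof.
transitivity (act X ∘ (idm A ⊗ yd_theta X) ∘ coact X).
  rewrite /yd_theta_inv; diagram (yd_theta_coact, exhaust (antipodeK hA)).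
rewrite /yd_theta; diagram (esym (act_mul hX), esym (coact_comul hX), antipode_r hA,
  coact_counit hX, act_one hX).
Qed.

Lemma yd_theta_iso : is_iso (yd_theta X).
Proof.
exists yd_theta_inv; rewrite /is_inverse; have [-> ->] := yd_theta_hom; split.
  by rewrite /yd_theta_inv; diagram_hom.
by split; [exact: yd_thetaK | exact: yd_theta_invK].
Qed.

End One.
Hint Resolve yd_theta_hom : hom.

Lemma yd_theta_natural (X Y : yd C) (f : Mor C) : is_yd A X -> is_yd A Y ->
  is_yd_morphism A X Y f -> yd_theta Y ∘ f = f ∘ yd_theta X.
Proof. move=> hX hY [hf lf cf]; rewrite /yd_theta; diagram (cf) | (lf). Qed.

Section Two.
Variables X Y : yd C.
Hypothesis hX : is_yd A X.
Hypothesis hY : is_yd A Y.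

(* The next three lemmas and [yd_theta_monoidal] compute [theta] on a tensor product: the
   antipode distributes over the two coactions, each of which then meets one of the two
   Yetter-Drinfel'd braidings and cancels its action. *)

Lemma tens_act_antipode :
  act (yd_tens A X Y) ∘ (SA ⊗ act X ⊗ idm Y) ∘ (idm (A ⊠ A) ⊗ br Y X) ∘
    (comul A ⊗ idm (Y ⊠ X)) ∘ (coact Y ⊗ idm X) = (idm X ⊗ yd_theta Y) ∘ br Y X.
Proof.
rewrite /yd_theta /=.
diagram (antipode_comul hA, comul_coassoc hA, esym (act_mul hX), antipode_l hA,
  act_one hX, counit_comul_r hA).
Qed.

Lemma yd_theta_tens_br : yd_theta (yd_tens A X Y) ∘ yd_br A Y X =
  act (yd_tens A X Y) ∘ (SA ⊗ idm X ⊗ yd_theta Y) ∘ (coact X ⊗ idm Y) ∘ br Y X.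
Proof.
have hXY := yd_tens_is_yd hA hX hY.
have hXYact : act (yd_tens A X Y) ∈ A ⊠ X ⊠ Y ⟶ X ⊠ Y := act_hom hXY.
have e := tens_act_antipode.
have am := act_mul hXY.
rewrite {1}/yd_theta /yd_br; set t := act (yd_tens A X Y) in hXYact e am *.
diagram (esym (coact_comul hY), esym (yd_condition hX), antipode_mul hA, am, e).
Qed.

Lemma tens_act_tw :
  act (yd_tens A X Y) ∘ (SA ⊗ idm X ⊗ yd_theta Y) ∘ br Y (A ⊠ X) ∘ (act Y ⊗ idm (A ⊠ X)) ∘
    (idm A ⊗ br (A ⊠ X) Y) ∘ (comul A ⊗ idm (X ⊠ Y)) =
  ((act X ∘ (SA ⊗ idm X)) ⊗ yd_theta Y) ∘ br Y (A ⊠ X) ∘ br (A ⊠ X) Y.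
Proof.
transitivity (br Y X ∘ ((act Y ∘ (SA ⊗ yd_theta Y) ∘ br Y A ∘ (act Y ⊗ idm A) ∘ (idm A ⊗ br A Y) ∘
   (comul A ⊗ idm Y)) ⊗ idm X) ∘ (idm A ⊗ br X Y) ∘
   (((idm A ⊗ (act X ∘ (SA ⊗ idm X))) ∘ (comul A ⊗ idm X)) ⊗ idm Y)).
  rewrite /=; diagram (antipode_comul hA) | (comul_coassoc hA).
rewrite (yd_theta_act_counit hY); diagram (counit_comul_l hA).
Qed.

(** [theta] intertwines the double braidings of [C] and of Yetter-Drinfel'd modules, as a
    balancing does. *)
Lemma yd_theta_monoidal : yd_theta (yd_tens A X Y) ∘ yd_br A Y X ∘ yd_br A X Y =
  (yd_theta X ⊗ yd_theta Y) ∘ br Y X ∘ br X Y.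
Proof.
have hXY := yd_tens_is_yd hA hX hY.
have hXYact : act (yd_tens A X Y) ∈ A ⊠ X ⊠ Y ⟶ X ⊠ Y := act_hom hXY.
have e := tens_act_tw.
rewrite yd_theta_tens_br [in RHS]/yd_theta -/(yd_theta Y) /yd_br.
set t := act (yd_tens A X Y) in hXYact e *.
diagram (esym (coact_comul hX), e).
Qed.
End Two.

End Theta.

(** * The functor applied twice *)

Section Double.
Variables (C : braided_category) (A B : bialg C) (SA TA SB TB k k' : Mor C).
Hypothesis hA : hopf_with A SA TA.
Hypothesis hB : hopf_with B SB TB.
Hypothesis hk : pairing_with B A k k'.
Local Notation k2 := (minus_pairing B A TB TA k).
Local Notation k2' := (minus_copairing B A SB SA k').
Let hk2 : pairing_with A B k2 k2' := minus_pairing_with hB hA hk.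

Section Module.
Variable X : yd C.
Hypothesis hX : is_yd A X.

(** The zigzag of [k] and [k'] leaves the action of [A]; what remains of the antipodes and
    braidings of the two pairings is a square and a double braiding. *)
Lemma dual_yd_twice_act : act (dual_yd B A k2 k2' (dual_yd A B k k' X)) =
  act X ∘ inv (br A X) ∘ inv (br X A) ∘ ((TA ∘ TA) ⊗ idm X).
Proof.
have e : k2 = k ∘ inv (br B A) ∘ ((TA ∘ TA) ⊗ idm B).
  rewrite /minus_pairing; diagram (pairing_inv_antipode hB hA hk).
rewrite /dual_yd /= /dual_act /= e /dual_rcoact /ract; diagram (snake_r hk).
Qed.

Lemma dual_yd_twice_coact : coact (dual_yd B A k2 k2' (dual_yd A B k k' X)) =
  br X A ∘ br A X ∘ ((SA ∘ SA) ⊗ idm X) ∘ coact X.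
Proof.
have e : k2' = (idm B ⊗ (SA ∘ SA)) ∘ br A B ∘ k'.
  rewrite /minus_copairing; diagram_rhs (copairing_antipode hB hA hk).
have s : br X A ∘ (((k ⊗ idm X) ∘ (idm B ⊗ coact X) ∘ inv (br B X)) ⊗ idm A) ∘
    (idm X ⊗ (br A B ∘ k')) = br X A ∘ br A X ∘ coact X by diagram (snake_r hk).
transitivity (((SA ∘ SA) ⊗ idm X) ∘ (br X A ∘ br A X ∘ coact X)); last by diagram.
rewrite -s /dual_yd /= /dual_rcoact /= /ract /= /dual_act e; diagram.
Qed.
End Module.

Variable K : yd_bialg C.
Hypothesis hK : is_yd_hopf A K.
Local Notation X := (yd_mod K).
Local Notation OX := (dual_yd A B k k' X).
Local Notation K1 := (dual_yd_bialg A B TA k k' K).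
Local Notation K2 := (dual_yd_bialg B A TB k2 k2' K1).
Let hX : is_yd A X := yd_hopf_yd hK.
Let hOX : is_yd B OX := dual_is_yd hA hB hk hX.
Let hK1 : is_yd_hopf B K1 := dual_yd_hopf hA hB hk hK.
Let hK2 : is_yd_hopf A K2 := dual_yd_hopf hB hA hk2 hK1.
Local Notation th := (yd_theta SA X).
Let th_hom : th ∈ X ⟶ X := yd_theta_hom hA hX.
Let hXX : is_yd A (yd_tens A X X) := yd_tens_is_yd hA hX hX.
Let e := constraint A X X.
Let e' := constraint B OX OX.
Let ei := constraint_inv A TA X X.
Let ei' := constraint_inv B TB OX OX.
Let thXX := yd_theta SA (yd_tens A X X).
Let e_hom : e ∈ X ⊠ X ⟶ X ⊠ X := constraint_hom hX hX.
Let ei_hom : ei ∈ X ⊠ X ⟶ X ⊠ X := constraint_inv_hom hA hX hX.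
Let e'_hom : e' ∈ X ⊠ X ⟶ X ⊠ X := constraint_hom hOX hOX.
Let ei'_hom : ei' ∈ X ⊠ X ⟶ X ⊠ X := constraint_inv_hom hB hOX hOX.
Let thXX_hom : thXX ∈ X ⊠ X ⟶ X ⊠ X := yd_theta_hom hA hXX.
Let eiK : e ∘ ei = idm (X ⊠ X) := constraint_invK hA hX hX.
Let ei'K : e' ∘ ei' = idm (X ⊠ X) := constraint_invK hB hOX hOX.

(** The two constraints are the two braidings of [yd_theta_monoidal], as the functor is
    braided. *)
Lemma yd_theta_double : thXX ∘ e ∘ e' = th ⊗ th.
Proof.
have m := yd_theta_monoidal hA hX hX.
have h1 : e = yd_br A X X ∘ inv (br X X) := esym (Omega2E hX hX).
have h2 : e' = br X X ∘ e ∘ inv (br X X).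
  by rewrite /e' -(Omega2E hOX hOX) /Omega2 (constraint_braided hk hX hX).
have hb : yd_br A X X ∈ X ⊠ X ⟶ X ⊠ X by rewrite /yd_br; diagram_hom.
rewrite -/thXX in m.
diagram (h2, h1, h1, m).
Qed.

Lemma yd_theta_mul : th ∘ mul K2 = mul K ∘ (th ⊗ th).
Proof.
have n : th ∘ mul K = mul K ∘ thXX := yd_theta_natural hA hXX hX (yd_hopf_mul hK).
rewrite -yd_theta_double /= -/e -/e'; diagram n.
Qed.

Lemma yd_theta_comul : comul K ∘ th = (th ⊗ th) ∘ comul K2.
Proof.
have n : thXX ∘ comul K = comul K ∘ th := yd_theta_natural hA hX hXX (yd_hopf_comul hK).
rewrite -yd_theta_double /= -/ei -/ei'; diagram (esym n) | (ei'K, eiK).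
Qed.

(** [theta] is linear and colinear for the actions of the functor applied twice, by
    [yd_theta_act] and [yd_theta_coact], and multiplicative and comultiplicative by
    [yd_theta_double]; hence it is compatible with the biproducts. *)
Lemma yd_theta_biproduct : is_hopf_iso (biproduct A K2) (biproduct A K) (th ⊗ idm A).
Proof.
have [_ l1 c1] := yd_hopf_one hK; have [_ le ce] := yd_hopf_counit hK.
have m := yd_theta_mul; have d := yd_theta_comul; rewrite /= -/e -/e' -/ei -/ei' in m d.
have la : th ∘ act (yd_mod K2) = act X ∘ (idm A ⊗ th).
  have -> : act (yd_mod K2) = act X ∘ inv (br A X) ∘ inv (br X A) ∘ ((TA ∘ TA) ⊗ idm X).
    exact: (dual_yd_twice_act hX).
  diagram (yd_theta_act hA hX, exhaust (inv_antipodeK hA)).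
have lc : coact X ∘ th = (idm A ⊗ th) ∘ coact (yd_mod K2).
  have -> : coact (yd_mod K2) = br X A ∘ br A X ∘ ((SA ∘ SA) ⊗ idm X) ∘ coact X.
    exact: (dual_yd_twice_coact hX).
  diagram (yd_theta_coact hA hX).
have u : th ∘ one K = one K.
  by rewrite /yd_theta; diagram (c1, esym l1, antipode_one hA, counit_one hA).
have v : counit K ∘ th = counit K.
  by rewrite /yd_theta; diagram (le, esym ce, counit_antipode hA, counit_one hA).
have h2a : yd_act K2 ∈ A ⊠ K ⟶ K := yd_act_hom hK2.
have h2c : yd_coact K2 ∈ K ⟶ A ⊠ K := yd_coact_hom hK2.
split; last first.
  have [g [hg [g1 g2]]] := yd_theta_iso hA hX; have [dt ct] := th_hom; rewrite dt ct in hg g1 g2.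
  exists (g ⊗ idm A); rewrite /is_inverse !dom_tens !cod_tens !dom_idm !cod_idm dt ct.
  have [-> ->] := hg; split=> //.
  by split; last diagram (g2); diagram (g1).
move: la lc h2a h2c; rewrite /=.
set a2 := dual_act _ _ _; set c2 := _ ∘ dual_rcoact _ _ _ _ => la lc h2a h2c.
split; rewrite /= -/e -/e' -/ei -/ei' -/a2 -/c2; first by diagram_hom.
- diagram (m, la).
- diagram u.
- diagram (d, lc).
- diagram v.
Qed.
End Double.

(** * The theorem *)

Section ExplicitData.
Variable C : braided_category.

Lemma hopf_with_antipode (A : bialg C) : is_hopf A -> hopf_with A (antipode A) (inv (antipode A)).
Proof.
move=> [bA eA]; have [hS iS l r] := the_spec eA; rewrite -/(antipode A) in hS iS l r.
have [hT [TS ST]] := inv_spec iS; have [dS cS] := hS; rewrite dS cS in hT TS ST.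
by split.
Qed.

Lemma pairing_with_copairing (A B : bialg C) (w : Mor C) :
  is_hopf_pairing A B w -> is_nondegenerate A B w -> pairing_with A B w (copairing A B w).
Proof. by move=> [h1 h2 h3 h4 h5] /the_spec[h6 h7 h8]; split. Qed.

Lemma pairing_withP (A B : bialg C) (w w' : Mor C) :
  pairing_with A B w w' -> is_hopf_pairing A B w /\ is_nondegenerate A B w.
Proof. by move=> [*]; split; [split|exists w'; split]. Qed.

Lemma copairing_eq (A B : bialg C) (w w' : Mor C) : is_hopf A -> is_hopf B ->
  pairing_with A B w w' -> copairing A B w = w'.
Proof.
move=> /hopf_with_antipode hA /hopf_with_antipode hB hw; have [h n] := pairing_withP hw.
have hw' := pairing_with_copairing h n.
transitivity ((idm B ⊗ w ⊗ idm A) ∘ (copairing A B w ⊗ w')).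
  diagram_rhs (snake_l hw).
diagram (snake_r hw').
Qed.

Section Omega.
Variables (A B : bialg C) (w : Mor C).
Hypothesis hA : is_hopf A.
Hypothesis hB : is_hopf B.
Hypothesis hw : is_hopf_pairing A B w.
Hypothesis nw : is_nondegenerate A B w.
Let wA := hopf_with_antipode hA.
Let wB := hopf_with_antipode hB.
Let ww := pairing_with_copairing hw nw.

Lemma OmegaE (K : yd_bialg C) : is_yd_hopf A K -> Omega A B w K =
  dual_yd_bialg A B (inv (antipode A)) (pairing_minus A B w)
   (minus_copairing A B (antipode A) (antipode B) (copairing A B w)) K.
Proof.
move=> hK; have hX := yd_hopf_yd hK.
rewrite /Omega /dual_yd_bialg; congr YDBialg.
- rewrite (Omega2E hX hX); congr Bialg; congr comp.
  apply: (inv_eq (constraint_hom hX hX) (constraint_inv_hom wA hX hX)).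
    exact: (constraintK wA hX hX).
  exact: (constraint_invK wA hX hX).
- exact: (Omega_act_minus wA wB ww hX).
- rewrite [LHS](Omega_coact_minus wA wB ww hX) /= /dual_rcoact /ract.
  have hp : pairing_with B A _ _ := minus_pairing_with wA wB ww.
  have hc := copair_hom hp.
  diagram.
Qed.
End Omega.
End ExplicitData.

Section Isos.
Variables (C : braided_category) (H H' H'' : bialg C).
Hypothesis bH : is_bialgebra (br H H) H.

Lemma hopf_iso_id : is_hopf_iso H H (idm H).
Proof.
split; last by exists (idm H); rewrite /is_inverse !dom_idm !cod_idm (comp_idl (hom_idm _)).
split; [exact: hom_idm | by diagram ..].
Qed.

Lemma hopf_iso_comp f g : is_bialgebra (br H' H') H' -> is_bialgebra (br H'' H'') H'' ->
  is_hopf_iso H H' f -> is_hopf_iso H' H'' g -> is_hopf_iso H H'' (g ∘ f).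
Proof.
move=> bH' bH'' [[hf f1 f2 f3 f4] [f' f'P]] [[hg g1 g2 g3 g4] [g' g'P]].
have [hf' [ff' f'f]] := f'P; have [hg' [gg' g'g]] := g'P.
have [df cf] := hf; have [dg cg] := hg; rewrite df cf dg cg in hf' ff' f'f hg' gg' g'g.
have hgf : g ∘ f ∈ H ⟶ H'' by diagram_hom.
have [dgf cgf] := hgf.
split; last first.
  exists (f' ∘ g'); rewrite /is_inverse dgf cgf; split; first by diagram_hom.
  split; first by diagram (gg', ff').
  diagram (f'f, g'g).
split=> //.
- diagram (f1, g1).
- diagram (f2, g2).
- diagram (g3, f3).
- diagram (g4, f4).
Qed.
End Isos.

Theorem corollary4p3 (C : braided_category) (H : bialg C) (D : pd_datum C)
    (K : yd_bialg C) (phi : Mor C) :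
  has_equalizers C ->
  tensor_preserves_equalizers (carrier (pd_A D)) ->
  tensor_preserves_equalizers (carrier (pd_B D)) ->
  is_hopf H ->
  is_pd_datum H D ->
  is_radford_decomposition H D K phi ->
  let rH := partial_dual D K in
  let OmK := pd_coinv D K in
  let Dm := pd_datum_minus D K in
  let rrH := partial_dual Dm OmK in
  let f := theta (pd_A D) K ⊗ idm (carrier (pd_A D)) in
  (is_hopf rH /\ is_pd_datum rH Dm /\
   is_radford_decomposition rH Dm OmK (idm (carrier rH))) /\
  is_hopf rrH /\
  is_hopf_iso rrH (biproduct (pd_A D) K) f /\
  is_hopf_iso rrH H (phi ∘ f).
Proof.
move=> _ _ _ hH [hA hB _ _ _ hw nw] [hK iphi _ _ _].
set A := pd_A D in hA hw nw hK iphi *; set B := pd_B D in hB hw nw *.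
set w := pd_pairing D in hw nw.
have wA := hopf_with_antipode hA; have wB := hopf_with_antipode hB.
have ww := pairing_with_copairing hw nw.
have wk := minus_pairing_with wA wB ww.
rewrite /partial_dual /pd_datum_minus /pd_coinv /= -/A -/B -/w.
have [hk nk] := pairing_withP wk.
have eOm := OmegaE hA hB hw nw hK.
have hOm : is_yd_hopf B (Omega A B w K) by rewrite eOm; exact: (dual_yd_hopf wA wB wk hK).
have hrH := biproduct_hopf wB hOm.
have eOm2 := OmegaE hB hA hk nk hOm; rewrite (copairing_eq hB hA wk) in eOm2.
have wk2 := minus_pairing_with wB wA wk.
have hOm2 : is_yd_hopf A (Omega B A (pairing_minus A B w) (Omega A B w K)).
  by rewrite [Omega B A _ _]eOm2; exact: (dual_yd_hopf wB wA wk2 hOm).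
have htw : is_hopf_iso (biproduct A (Omega B A (pairing_minus A B w) (Omega A B w K)))
    (biproduct A K) (theta A K ⊗ idm A).
  rewrite [Omega B A _ _]eOm2 eOm; exact: (yd_theta_biproduct wA wB wk hK).
split; last first.
  split; first exact: (biproduct_hopf wA hOm2).
  split=> //; apply: (hopf_iso_comp _ _ (proj1 hH) htw iphi).
    exact: (proj1 (biproduct_hopf wA hOm2)).
  exact: (proj1 (biproduct_hopf wA hK)).
split; first exact: hrH.
have hid := biproduct_bialgebra wB hOm.
split.
  split=> //=.
  - exact: (biproduct_proj wB hOm).
  - exact: (biproduct_incl wB hOm).
  - exact: (biproduct_split hOm).
split=> /=.
- exact: hOm.
- exact: (hopf_iso_id hid).
- diagram.
- diagram.
- have -> : idm (K ⊠ B) ∘ (idm K ⊗ one B) = idm K ⊗ one B by diagram.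
  exact: (biproduct_coinvariants wB hOm).
Qed.
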